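(* Let $n\geq 2$, let $k\in\mathbb{N}\cup\{\infty\}$, let $\Omega\subset\mathbb{R}^n$ be open and let $D_1$ and $D_2$ be $C^k$-closed balls in $\mathbb{R}^n$ such that $D_2\subset\mathring{D}_1\subset D_1\subset\Omega$. If $F:\Omega\to\mathbb{R}^n$ and $G:D_2\to\mathbb{R}^n$ are orientation preserving $C^k$-diffeomorphisms (onto their images) satisfying $G(D_2)\subset F(\mathring{D}_1)$, then there is a $C^k$-diffeomorphism $H$ of $\Omega$ onto $F(\Omega)$ such that $H=F$ on $\Omega\setminus\mathring{D}_1$ and $H=G$ on $D_2$.
   Context: $\mathbb{N}$ is the set of positive integers; $\mathring{D}$ is the interior of $D$. $B^n(x,r)$ is the open Euclidean ball in $\mathbb{R}^n$ and $\mathbb{B}^n=B^n(0,1)$. If $A\subset\mathbb{R}^n$ is closed, a $C^k$-diffeomorphism $G:A\to\mathbb{R}^n$ means a mapping that extends to a $C^k$-diffeomorphism (onto its image) on an open neighborhood of $A$. A closed set $D\subset\mathbb{R}^n$ is a $C^k$-closed ball if there is a $C^k$-diffeomorphism of $\overline{\mathbb{B}}^n$ onto $D$; in other words, there are $\varepsilon>0$ and a $C^k$-diffeomorphism $\Phi:B^n(0,1+\varepsilon)\to\mathbb{R}^n$ (onto its image) such that $\Phi(\overline{B}^n(0,1))=D$. *)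

(* Defs.v *)
From mathcomp Require Export all_boot all_order all_algebra.
From mathcomp Require Export all_classical all_reals all_analysis.
Import Order.TTheory GRing.Theory Num.Theory.
Import numFieldNormedType.Exports.

Set Implicit Arguments.
Unset Strict Implicit.
Unset Printing Implicit Defensive.

Local Open Scope classical_set_scope.
Local Open Scope ring_scope.

(* R^n is 'rV[R]_n. Its library topology comes from the sup norm and is the
   Euclidean topology; only Euclidean balls need the norm defined here. Maps
   defined on a subset of R^n are total functions of which only the values on
   that subset matter. *)

Definition enorm (R : realType) n (x : 'rV[R]_n) : R :=
  Num.sqrt (\sum_(i < n) x 0 i ^+ 2).

Definition eball (R : realType) n (x : 'rV[R]_n) (r : R) : set 'rV[R]_n :=
  [set y | enorm (y - x) < r].

Definition closed_eball (R : realType) n (x : 'rV[R]_n) (r : R) :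
    set 'rV[R]_n :=
  [set y | enorm (y - x) <= r].

Variant smoothness := Finite_order of nat | Infinite_order.

Definition positive_order (k : smoothness) : bool :=
  if k is Finite_order m then (0 < m)%N else true.

(* [U] is meant to be open, so that the pointwise notions of continuity and
   differentiability depend only on the values of [f] on [U]. *)
Fixpoint Cn (R : realType) n p (m : nat) (U : set 'rV[R]_n)
    (f : 'rV[R]_n -> 'rV[R]_p) : Prop :=
  if m is m'.+1 then
    (forall x, U x -> differentiable f x) /\
    (forall v : 'rV[R]_n, Cn m' U (fun x => 'D_v f x))
  else forall x, U x -> {for x, continuous f}.

Definition Ck (R : realType) n p (k : smoothness) (U : set 'rV[R]_n)
    (f : 'rV[R]_n -> 'rV[R]_p) : Prop :=
  match k with
  | Finite_order m => Cn m U f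
  | Infinite_order => forall m, Cn m U f
  end.

Definition Ck_diffeo (R : realType) n (k : smoothness) (U V : set 'rV[R]_n)
    (f : 'rV[R]_n -> 'rV[R]_n) : Prop :=
  [/\ open U, open V, f @` U = V, Ck k U f &
      exists g : 'rV[R]_n -> 'rV[R]_n,
        Ck k V g /\ (forall x, U x -> g (f x) = x)].

Definition orientation_preserving (R : realType) n (A : set 'rV[R]_n)
    (f : 'rV[R]_n -> 'rV[R]_n) : Prop :=
  forall x, A x -> 0 < \det (jacobian f x).

Definition Ck_diffeo_extension (R : realType) n (k : smoothness)
    (A : set 'rV[R]_n) (f : 'rV[R]_n -> 'rV[R]_n)
    (U : set 'rV[R]_n) (g : 'rV[R]_n -> 'rV[R]_n) : Prop :=
  [/\ A `<=` U, Ck_diffeo k U (g @` U) g & forall x, A x -> g x = f x].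

(* The Jacobian at a boundary point of [A] is that of an extension, since [f]
   carries no information outside [A]. *)
Definition orientation_preserving_closed_Ck_diffeo (R : realType) n
    (k : smoothness) (A : set 'rV[R]_n) (f : 'rV[R]_n -> 'rV[R]_n) : Prop :=
  closed A /\
  exists (U : set 'rV[R]_n) (g : 'rV[R]_n -> 'rV[R]_n),
    Ck_diffeo_extension k A f U g /\ orientation_preserving A g.

Definition Ck_closed_ball (R : realType) n (k : smoothness)
    (D : set 'rV[R]_n) : Prop :=
  closed D /\
  exists (e : R) (Phi : 'rV[R]_n -> 'rV[R]_n),
    [/\ 0 < e,
        Ck_diffeo k (eball 0 (1 + e)) (Phi @` eball 0 (1 + e)) Phi &
        Phi @` closed_eball 0 1 = D].

(* Main.v *)
From HB Require Import structures.
From mathcomp Require Import ring lra.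
Require Import Defs.
Import Order.TTheory GRing.Theory Num.Theory.
Import numFieldNormedType.Exports.

Set Implicit Arguments.
Unset Strict Implicit.
Unset Printing Implicit Defensive.

Local Open Scope classical_set_scope.
Local Open Scope ring_scope.

(** Write U for the interior of D1 and let a be the parametrization of D2 by
    the closed unit ball. Since G maps D2 into F(U), the map b = F^-1 o G o a
    is a second embedding of a neighbourhood of the closed unit ball into U,
    and a and b have Jacobians of the same sign at 0. It suffices to find a
    C^k-diffeomorphism M of R^n, equal to the identity off a compact subset
    of U, with M o a = b on the closed unit ball: then H = F o M. So the
    heart of the matter is [disc_theorem], a form of Palais' theorem that
    equally oriented discs in a connected manifold are ambiently equivalent.

    Isotopy extension by flows of vector fields would cost a derivative when
    k is finite. Instead, every diffeomorphism here is a composite of maps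
    x + u(x), with u of class C^k, compactly supported and 1/2-Lipschitz. Such
    a map is bijective by the contraction principle, and its inverse is C^k
    because the derivative of the inverse is an inverse matrix
    ([cdiff_perturbation]). Any compactly supported C^k field qualifies after
    multiplication by a small constant ([cdiff_small]), and iterating the
    result gives large displacements. Diffeomorphisms supported in U form a
    group, and an embedding transports those of its domain to its image
    ([cdiff_transport]).

    The discs are matched in four moves. (1) A translation inside the unit
    ball, transported by the parametrization of D1, moves a(0) to b(0) and
    has positive Jacobian there, because the Jacobian of a parametrization
    does not change sign on a ball ([ball_image_transitive]). (2) The linear
    part A of the remaining germ has positive determinant, hence is a product
    of elementary matrices ([elementary_generate]), each of which is a power
    of a matrix close to the identity ([linear_germ_realized]). (3) What
    remains is a germ d with d(q) = q and derivative the identity there;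
    d - id has a small Lipschitz constant near q, and cutting it off on a ball
    of radius delta only multiplies this constant by a bound independent of
    delta, because d - id vanishes at q ([identity_germ_realized]). (4) This
    makes M o a = b on a small ball only; conjugating by transported
    contractions of the parameter ball, which are x |-> c x on the unit ball
    ([cdiff_shrink]), spreads the equality to the closed unit ball. *)

(** * Differentiability from error estimates *)

Section FrechetCriterion.
Context {R : realType} {V W : normedModType R}.
Implicit Types (f g : V -> W) (x : V).

(** The derivative is defined through a choice of a linear map; this
    criterion identifies it without mentioning little-o terms. *)
Lemma is_diff_of_estimate f x (L : {linear V -> W}) : continuous L ->
  (forall e, 0 < e ->
     \forall h \near (0 : V), `|f (h + x) - f x - L h| <= e * `|h|) ->
  is_diff x f L.
Proof.
move=> Lc fL.
have fo : f \o shift x = cst (f x) + L +o_ 0 id.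
  apply/eqaddoP => e e0; near=> h.
  rewrite [X in `|X|](_ : _ = f (h + x) - f x - L h); last first.
    by rewrite /= !fctE /= opprD addrA.
  by near: h; exact: fL.
have dL := diff_unique Lc fo.
apply: DiffDef => //; apply/diff_locallyP; split; first by rewrite dL.
by rewrite dL.
Unshelve. all: by end_near. Qed.

Lemma diff_estimate f x (e : R) : differentiable f x -> 0 < e ->
  \forall h \near (0 : V), `|f (h + x) - f x - 'd f x h| <= e * `|h|.
Proof.
move=> /diff_locallyP[_ /eqaddoP fo] e0; near=> h.
rewrite [X in `|X|](_ : _ = (f \o shift x - (cst (f x) + 'd f x)) h); last first.
  by rewrite /= !fctE /= opprD addrA.
by near: h; exact: fo.
Unshelve. all: by end_near. Qed.

Lemma near_eq_is_diff f g x (df : V -> W) :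
  (\forall y \near x, f y = g y) -> is_diff x f df -> is_diff x g df.
Proof.
move=> fg fd.
have df' : differentiable f x by exact: ex_diff.
suff : is_diff x g ('d f x) by rewrite diff_val.
apply: is_diff_of_estimate; first exact: diff_continuous.
have shift_x : (fun h => h + x) @ (0 : V) --> x.
  by rewrite -[X in _ --> X]add0r; apply: cvgD; [exact: cvg_id|exact: cvg_cst].
move=> e e0; near=> h.
rewrite -(nbhs_singleton fg) -(_ : f (h + x) = g (h + x)).
  by near: h; exact: diff_estimate.
by near: h; exact: shift_x fg.
Unshelve. all: by end_near. Qed.

Lemma near_eq_differentiable f g x :
  (\forall y \near x, f y = g y) -> differentiable f x -> differentiable g x.
Proof. by move=> fg /differentiableP/(near_eq_is_diff fg)[]. Qed.

End FrechetCriterion.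

(** * Calculus of scalar functions of class C^m *)

(** The calculus is done for scalar functions, where products and inverses
    exist; vector-valued maps are then treated componentwise, by [CnP]. *)
Fixpoint Cs (R : realType) (V : normedModType R) (m : nat) (U : set V)
    (f : V -> R) : Prop :=
  if m is m'.+1 then
    (forall x, U x -> differentiable f x) /\
    (forall v : V, Cs m' U (fun x => 'D_v f x))
  else forall x, U x -> {for x, continuous f}.

Section CsCalculus.
Context {R : realType} {V : normedModType R}.
Implicit Types (f g : V -> R) (U : set V) (m : nat).

Lemma Cs_sub m U U' f : U `<=` U' -> Cs m U' f -> Cs m U f.
Proof.
move=> UU'; elim: m f => [|m IH] f /=; first by move=> cf x /UU' /cf.
by case=> df Df; split=> [x /UU' /df//|v]; exact/IH/Df.
Qed.

(** The definition is pointwise, so that a function given by two formulas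
    on two open sets may be treated on each of them separately. *)
Lemma CsU m A B f : Cs m A f -> Cs m B f -> Cs m (A `|` B) f.
Proof.
elim: m f => [|m IH] f /=; first by move=> cA cB x [/cA|/cB].
by case=> dA DA [dB DB]; split=> [x [/dA|/dB]//|v]; exact: IH.
Qed.

Lemma CsS m U f : Cs m.+1 U f -> Cs m U f.
Proof.
elim: m f => [|m IH] f; first by case=> df _ x /df /differentiable_continuous.
by case=> df Df; split=> // v; exact/IH/Df.
Qed.

Lemma Cs_le m m' U f : (m' <= m)%N -> Cs m U f -> Cs m' U f.
Proof.
elim: m => [|m IH]; first by rewrite leqn0 => /eqP ->.
by rewrite leq_eqVlt => /predU1P[->//|/IH h] /CsS.
Qed.

Lemma Cs_continuous m U f : Cs m U f -> forall x, U x -> {for x, continuous f}.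
Proof. by move=> /(Cs_le (leq0n m)). Qed.

(** Openness is needed: differentiability at a point sees the values
    nearby. *)
Lemma Cs_ext m U f g : open U -> (forall x, U x -> f x = g x) ->
  Cs m U f -> Cs m U g.
Proof.
move=> oU; elim: m f g => [|m IH] f g fg.
  move=> cf x Ux; have nfg : \forall y \near x, f y = g y.
    by apply: filterS (open_nbhs_nbhs (conj oU Ux)) => y /fg.
  rewrite /prop_for /continuous_at -(fg _ Ux).
  by apply: cvg_trans (cf x Ux); apply: near_eq_cvg.
case=> df Df; split.
  move=> x Ux; apply: near_eq_differentiable (df x Ux).
  by apply: filterS (open_nbhs_nbhs (conj oU Ux)) => y /fg.
move=> v; apply: IH (Df v) => x Ux; apply: near_eq_derive.
by apply: filterS (open_nbhs_nbhs (conj oU Ux)) => y /fg.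
Qed.

Lemma Cs_cst m U (c : R) : Cs m U (fun=> c).
Proof.
elim: m c => [|m IH] c; first by move=> x _; exact: cvg_cst.
split=> [x _|v]; first exact: differentiable_cst.
have -> : (fun x => 'D_v (fun=> c) x) = fun=> 0; last exact: IH.
by apply/funext => x; rewrite derive_cst.
Qed.

Lemma CsD m U f g : open U -> Cs m U f -> Cs m U g ->
  Cs m U (fun x => f x + g x).
Proof.
move=> oU; elim: m f g => [|m IH] f g.
  by move=> cf cg x Ux; apply: cvgD; [exact: cf|exact: cg].
case=> df Df [dg Dg]; split=> [x Ux|v].
  by apply: differentiableD; [exact: df|exact: dg].
apply: (Cs_ext _ _ (IH _ _ (Df v) (Dg v))) => // x Ux.
by rewrite deriveD//; apply: diff_derivable; [exact: df|exact: dg].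
Qed.

Lemma CsM m U f g : open U -> Cs m U f -> Cs m U g ->
  Cs m U (fun x => f x * g x).
Proof.
move=> oU; elim: m f g => [|m IH] f g.
  by move=> cf cg x Ux; apply: cvgM; [exact: cf|exact: cg].
move=> Cf Cg; have [[df Df] [dg Dg]] := (Cf, Cg); split=> [x Ux|v].
  by apply: differentiableM; [exact: df|exact: dg].
have := CsD oU (IH _ _ (CsS Cf) (Dg v)) (IH _ _ (CsS Cg) (Df v)).
apply: Cs_ext => // x Ux.
by rewrite deriveM//; apply: diff_derivable; [exact: df|exact: dg].
Qed.

Lemma CsN m U f : open U -> Cs m U f -> Cs m U (fun x => - f x).
Proof.
move=> oU /(CsM oU (Cs_cst m U (-1))).
by apply: Cs_ext => // x _; rewrite mulN1r.
Qed.

Lemma CsB m U f g : open U -> Cs m U f -> Cs m U g ->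
  Cs m U (fun x => f x - g x).
Proof. by move=> oU Cf Cg; apply: CsD => //; exact: CsN. Qed.

Lemma Cs_sum (I : Type) (r : seq I) m U (F : I -> V -> R) : open U ->
  (forall i, Cs m U (F i)) -> Cs m U (fun x => \sum_(i <- r) F i x).
Proof.
move=> oU CF; elim: r => [|i r IH].
  by apply: Cs_ext (Cs_cst m U 0) => // x _; rewrite big_nil.
by apply: Cs_ext (CsD oU (CF i) IH) => // x _; rewrite big_cons.
Qed.

Lemma Cs_prod (I : Type) (r : seq I) m U (F : I -> V -> R) : open U ->
  (forall i, Cs m U (F i)) -> Cs m U (fun x => \prod_(i <- r) F i x).
Proof.
move=> oU CF; elim: r => [|i r IH].
  by apply: Cs_ext (Cs_cst m U 1) => // x _; rewrite big_nil.
by apply: Cs_ext (CsM oU (CF i) IH) => // x _; rewrite big_cons.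
Qed.

Lemma CsV m U f : open U -> (forall x, U x -> f x != 0) -> Cs m U f ->
  Cs m U (fun x => (f x)^-1).
Proof.
move=> oU f0; elim: m f f0 => [|m IH] f f0.
  by move=> cf x Ux; apply: cvgV; [exact: f0|exact: cf].
move=> Cf; have [df Df] := Cf; split=> [x Ux|v].
  by apply: differentiableV; [exact: df|exact: f0].
have := CsM oU (IH _ f0 (CsS Cf)) (IH _ f0 (CsS Cf)).
move=> /(CsM oU)/(_ (Df v))/(CsN oU); apply: Cs_ext => // x Ux.
rewrite deriveV; [|exact: f0|by apply: diff_derivable; exact: df].
by rewrite -mulNr -invfM -expr2.
Qed.

End CsCalculus.

(** * Components and composition *)

Section CsComposition.
Context {R : realType}.

Lemma continuous_rowP (T : topologicalType) p (f : T -> 'rV[R]_p) x :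
  (forall i, {for x, continuous (fun y => f y 0 i)}) -> {for x, continuous f}.
Proof.
move=> fc.
have -> : f = fun y => \sum_(i < p) f y 0 i *: delta_mx 0 i.
  by apply/funext => y; exact: row_sum_delta.
apply: cvg_big => [|i _]; first exact: add_continuous.
by apply: cvgZr_tmp; exact: fc.
Qed.

Lemma differentiable_rowP (V : normedModType R) p (f : V -> 'rV[R]_p) x :
  differentiable f x <-> forall i, differentiable (fun y => f y 0 i) x.
Proof.
split=> [df i|df].
  apply: (@differentiable_comp _ _ _ _ f (fun M : 'rV_p => M 0 i)) => //.
  exact: differentiable_coord.
have -> : f = \sum_(i < p) (fun y => f y 0 i *: delta_mx 0 i).
  by apply/funext => y; rewrite fct_sumE; exact: row_sum_delta.
by apply: differentiable_sum => i; exact: differentiableZl.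
Qed.

Lemma derive_rowE (V : normedModType R) p (f : V -> 'rV[R]_p) x v i :
  differentiable f x -> ('D_v f x) 0 i = 'D_v (fun y => f y 0 i) x.
Proof. by move=> df; rewrite derive_mx ?mxE//; exact: diff_derivable. Qed.

Lemma Cs_coord n m (U : set 'rV[R]_n) i : Cs m U (fun x => x 0 i).
Proof.
case: m => [|m]; first by move=> x _; exact: coord_continuous.
split=> [x _|v]; first exact: differentiable_coord.
have -> : (fun x : 'rV[R]_n => 'D_v (fun y : 'rV[R]_n => y 0 i) x) =
    fun=> v 0 i; last exact: Cs_cst.
apply/funext => x; rewrite -(derive_rowE (f := id)) ?derive_id//.
Qed.

Lemma CnP n p m (U : set 'rV[R]_n) (f : 'rV[R]_n -> 'rV[R]_p) :
  open U -> Cn m U f <-> forall i, Cs m U (fun x => f x 0 i).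
Proof.
move=> oU; elim: m f => [|m IH] f.
  split=> [cf i x Ux|cf x Ux].
    apply: (@continuous_comp _ _ _ f (fun M : 'rV_p => M 0 i)).
      exact: cf.
    exact: coord_continuous.
  by apply: continuous_rowP => i; exact: cf.
split=> [[df Df] i|Cf].
  split=> [x Ux|v]; first by move/differentiable_rowP : (df x Ux).
  have := (IH _).1 (Df v) i; apply: Cs_ext => // x Ux.
  by rewrite derive_rowE//; exact: df.
have df x : U x -> differentiable f x.
  by move=> Ux; apply/differentiable_rowP => i; exact: (Cf i).1.
split=> // v; apply/IH => i; apply: Cs_ext ((Cf i).2 v) => // x Ux.
by rewrite derive_rowE//; exact: df.
Qed.

Arguments CnP {n p m U f}.

Lemma CnS n p m (U : set 'rV[R]_n) (f : 'rV[R]_n -> 'rV[R]_p) :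
  open U -> Cn m.+1 U f -> Cn m U f.
Proof. by move=> oU /(CnP oU) Cf; apply/(CnP oU) => i; exact/CsS. Qed.

Lemma Cn_le n p m m' (U : set 'rV[R]_n) (f : 'rV[R]_n -> 'rV[R]_p) :
  open U -> (m' <= m)%N -> Cn m U f -> Cn m' U f.
Proof.
by move=> oU mm /(CnP oU) Cf; apply/(CnP oU) => i; exact: Cs_le mm (Cf i).
Qed.

(** The chain rule in coordinates: it expresses the derivatives of a
    composite by products of functions of one class less, which makes the
    induction of [Cs_comp] work. *)
Lemma derive_compE n p (f : 'rV[R]_p -> R) (g : 'rV[R]_n -> 'rV[R]_p) x v :
  differentiable g x -> differentiable f (g x) ->
  'D_v (f \o g) x =
    \sum_(i < p) 'D_v (fun y => g y 0 i) x * 'D_(delta_mx 0 i) f (g x).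
Proof.
move=> dg df.
rewrite deriveE; last exact: differentiable_comp.
rewrite diff_comp//= -(deriveE v dg) [X in 'd f (g x) X](row_sum_delta) linear_sum.
by apply: eq_bigr => i _; rewrite linearZ/= -derive_rowE// (deriveE _ df).
Qed.

Lemma Cs_comp n p m (U : set 'rV[R]_n) (W : set 'rV[R]_p)
    (f : 'rV[R]_p -> R) (g : 'rV[R]_n -> 'rV[R]_p) :
  open U -> open W -> (forall x, U x -> W (g x)) ->
  Cs m W f -> Cn m U g -> Cs m U (f \o g).
Proof.
move=> oU oW gU; elim: m f => [|m IH] f.
  by move=> cf cg x Ux; apply: continuous_comp; [exact: cg|exact/cf/gU].
move=> Cf Cg; have [[df Df] [dg Dg]] := (Cf, Cg); split=> [x Ux|v].
  by apply: differentiable_comp; [exact: dg|exact/df/gU].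
have gm : Cn m U g by exact: CnS.
have H i : Cs m U (fun x => 'D_v (fun y => g y 0 i) x *
    'D_(delta_mx 0 i) f (g x)).
  apply: CsM => //; last exact: (IH _ (Df _) gm).
  exact: ((CnP oU).1 Cg i).2.
apply: Cs_ext (Cs_sum (index_enum 'I_p) oU H) => // x Ux.
by rewrite derive_compE//; [exact: dg|exact/df/gU].
Qed.

Lemma Cs_comp1 (V : normedModType R) m (U : set V) (W : set R)
    (f : R -> R) (g : V -> R) :
  open U -> open W -> (forall x, U x -> W (g x)) ->
  Cs m W f -> Cs m U g -> Cs m U (f \o g).
Proof.
move=> oU oW gU; elim: m f => [|m IH] f.
  by move=> cf cg x Ux; apply: continuous_comp; [exact: cg|exact/cf/gU].
move=> Cf Cg; have [[df Df] [dg Dg]] := (Cf, Cg); split=> [x Ux|v].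
  by apply: differentiable_comp; [exact: dg|exact/df/gU].
have := CsM oU (Dg v) (IH _ (Df 1) (CsS Cg)); apply: Cs_ext => // x Ux.
have dgx := dg x Ux; have dfx := df (g x) (gU _ Ux).
rewrite [RHS]deriveE; last exact: differentiable_comp.
rewrite diff_comp//= -(deriveE v dgx) [in LHS](deriveE _ dfx).
by rewrite -[in RHS](mulr1 ('D_v g x)) [RHS]linearZ.
Qed.

Lemma Cn_comp n p q m (U : set 'rV[R]_n) (W : set 'rV[R]_p)
    (f : 'rV[R]_p -> 'rV[R]_q) (g : 'rV[R]_n -> 'rV[R]_p) :
  open U -> open W -> (forall x, U x -> W (g x)) ->
  Cn m W f -> Cn m U g -> Cn m U (f \o g).
Proof.
move=> oU oW gU /(CnP oW) Cf Cg; apply/(CnP oU) => i.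
exact: (Cs_comp (f := fun y => f y 0 i)) oU oW gU (Cf i) Cg.
Qed.

End CsComposition.
Arguments CnP {R n p m U f}.

(** * Estimates for the sup norm *)

Section RowNorm.
Context {R : realType}.

Lemma coord_le_norm n (x : 'rV[R]_n) i : `|x 0 i| <= `|x|.
Proof.
rewrite [leRHS]/Num.Def.normr /= mx_normrE.
exact: (le_bigmax _ (fun ij : 'I_1 * 'I_n => `|x ij.1 ij.2|) (0, i)).
Qed.

Lemma norm_row_le n (x : 'rV[R]_n) e :
  0 <= e -> (forall i, `|x 0 i| <= e) -> `|x| <= e.
Proof.
move=> e0 xe; rewrite [leLHS]/Num.Def.normr /= mx_normrE.
by apply: bigmax_le => // -[i j] _; rewrite ord1.
Qed.

Lemma norm_mulmx_le n p (B : 'M[R]_(n, p)) :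
  exists2 c, 0 < c & forall v : 'rV[R]_n, `|v *m B| <= c * `|v|.
Proof.
exists (1 + \sum_(i < n) \sum_(j < p) `|B i j|).
  by rewrite ltr_wpDr// !sumr_ge0// => i _; rewrite sumr_ge0.
move=> v; have S0 (i : 'I_n) : 0 <= \sum_(j < p) `|B i j| by rewrite sumr_ge0.
apply: norm_row_le => [|j].
  by rewrite mulr_ge0// addr_ge0// sumr_ge0.
rewrite mxE (le_trans (ler_norm_sum _ _ _))//.
apply: (@le_trans _ _ (\sum_(i < n) `|v| * \sum_(j < p) `|B i j|)).
  apply: ler_sum => i _; rewrite normrM ler_pM// ?coord_le_norm//.
  by rewrite (bigD1 j)//= lerDl sumr_ge0.
by rewrite -mulr_sumr mulrC ler_wpM2r// lerDr.
Qed.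

Lemma lipschitz_continuous (V W : normedModType R) (f : V -> W) (c : R) :
  0 < c -> (forall x y, `|f x - f y| <= c * `|x - y|) -> continuous f.
Proof.
move=> c0 fc x; apply/cvgrPdist_le => e e0; apply/nbhs_normP.
exists (c^-1 * e) => [|y /= /ltW xy]; first by rewrite /= mulr_gt0// invr_gt0.
by rewrite (le_trans (fc _ _))// -ler_pdivlMl.
Qed.

Lemma mulmx_continuous n p (B : 'M[R]_(n, p)) :
  continuous (fun v : 'rV[R]_n => v *m B).
Proof.
have [c c0 cB] := norm_mulmx_le B.
apply: (lipschitz_continuous c0) => x y.
by rewrite -mulmxBl.
Qed.

Lemma unitmx_injective n (A : 'M[R]_n) :
  (forall v : 'rV[R]_n, v *m A = 0 -> v = 0) -> A \in unitmx.
Proof.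
move=> Ainj; rewrite -row_free_unit -kermx_eq0; apply/rowV0P => v.
by move/sub_kermxP => /Ainj.
Qed.

End RowNorm.

(** * Maps of class C^k, k finite or infinite *)

Section CkCalculus.
Context {R : realType}.
Implicit Types (k : smoothness) (n p : nat).

Definition order_le m k : bool := if k is Finite_order j then (m <= j)%N else true.

(** Both finite and infinite orders reduce to finite ones, so every
    closure property below is inherited from the finite case. *)
Lemma CkP n p k (U : set 'rV[R]_n) (f : 'rV[R]_n -> 'rV[R]_p) : open U ->
  Ck k U f <-> forall m, order_le m k -> Cn m U f.
Proof.
move=> oU; case: k => [j|]; split=> //=.
- by move=> Cf m mj; exact: Cn_le mj Cf.
- exact.
- by move=> Cf m; exact: Cf.
Qed.
Arguments CkP {n p k U f}.

Lemma Ck_coordP n p k (U : set 'rV[R]_n) (f : 'rV[R]_n -> 'rV[R]_p) : open U ->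
  Ck k U f <-> forall m, order_le m k -> forall i, Cs m U (fun x => f x 0 i).
Proof.
move=> oU; split=> [/(CkP oU) Cf m /Cf /(CnP oU)//|Cf].
by apply/(CkP oU) => m /Cf/(CnP oU).
Qed.
Arguments Ck_coordP {n p k U f}.

Lemma Ck_comp n p q k (U : set 'rV[R]_n) (W : set 'rV[R]_p)
    (f : 'rV[R]_p -> 'rV[R]_q) (g : 'rV[R]_n -> 'rV[R]_p) :
  open U -> open W -> (forall x, U x -> W (g x)) ->
  Ck k W f -> Ck k U g -> Ck k U (f \o g).
Proof.
move=> oU oW gU /(CkP oW) Cf /(CkP oU) Cg; apply/(CkP oU) => m mk.
exact: Cn_comp (Cf _ mk) (Cg _ mk).
Qed.

Lemma Ck_ext n p k (U : set 'rV[R]_n) (f g : 'rV[R]_n -> 'rV[R]_p) :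
  open U -> (forall x, U x -> f x = g x) -> Ck k U f -> Ck k U g.
Proof.
move=> oU fg /(Ck_coordP oU) Cf; apply/(Ck_coordP oU) => m mk i.
by apply: Cs_ext (Cf m mk i) => // x /fg ->.
Qed.

Lemma Ck_sub n p k (U U' : set 'rV[R]_n) (f : 'rV[R]_n -> 'rV[R]_p) :
  open U -> open U' -> U `<=` U' -> Ck k U' f -> Ck k U f.
Proof.
move=> oU oU' UU' /(Ck_coordP oU') Cf; apply/(Ck_coordP oU) => m mk i.
exact: Cs_sub UU' (Cf m mk i).
Qed.

Lemma CkU n p k (A B : set 'rV[R]_n) (f : 'rV[R]_n -> 'rV[R]_p) :
  open A -> open B -> Ck k A f -> Ck k B f -> Ck k (A `|` B) f.
Proof.
move=> oA oB /(Ck_coordP oA) CA /(Ck_coordP oB) CB; apply/(Ck_coordP (openU oA oB)) => m mk i.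
exact: CsU (CA m mk i) (CB m mk i).
Qed.

Lemma CkD n p k (U : set 'rV[R]_n) (f g : 'rV[R]_n -> 'rV[R]_p) :
  open U -> Ck k U f -> Ck k U g -> Ck k U (fun x => f x + g x).
Proof.
move=> oU /(Ck_coordP oU) Cf /(Ck_coordP oU) Cg; apply/(Ck_coordP oU) => m mk i.
by apply: Cs_ext (CsD oU (Cf m mk i) (Cg m mk i)) => // x _; rewrite mxE.
Qed.

Lemma Ck_cst n p k (U : set 'rV[R]_n) (c : 'rV[R]_p) :
  open U -> Ck k U (fun=> c).
Proof. by move=> oU; apply/(Ck_coordP oU) => m mk i; exact: Cs_cst. Qed.

Lemma Ck_id n k (U : set 'rV[R]_n) : open U -> Ck k U id.
Proof. by move=> oU; apply/(Ck_coordP oU) => m mk i; exact: Cs_coord. Qed.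

Lemma Ck_scale n p k (U : set 'rV[R]_n) (s : 'rV[R]_n -> R)
    (f : 'rV[R]_n -> 'rV[R]_p) : open U ->
  (forall m, order_le m k -> Cs m U s) -> Ck k U f ->
  Ck k U (fun x => s x *: f x).
Proof.
move=> oU Csm /(Ck_coordP oU) Cf; apply/(Ck_coordP oU) => m mk i.
by apply: Cs_ext (CsM oU (Csm m mk) (Cf m mk i)) => // x _; rewrite mxE.
Qed.

Lemma Ck_mulmx n p k (U : set 'rV[R]_n) (A : 'M[R]_(n, p)) :
  open U -> Ck k U (fun x => x *m A).
Proof.
move=> oU; apply/(Ck_coordP oU) => m mk i.
have H j : Cs m U (fun x => x 0 j * A j i).
  by apply: CsM => //; [exact: Cs_coord|exact: Cs_cst].
by apply: Cs_ext (Cs_sum (index_enum 'I_n) oU H) => // x _; rewrite mxE.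
Qed.

Lemma Ck_Cn1 n p k (U : set 'rV[R]_n) (f : 'rV[R]_n -> 'rV[R]_p) :
  open U -> positive_order k -> Ck k U f -> Cn 1 U f.
Proof. by move=> oU k0 /(CkP oU); apply; case: k k0. Qed.

Lemma Ck_continuous n p k (U : set 'rV[R]_n) (f : 'rV[R]_n -> 'rV[R]_p) :
  open U -> Ck k U f -> forall x, U x -> {for x, continuous f}.
Proof.
move=> oU /(CkP oU) Cf; have /Cf Cf0 : order_le 0%N k by case: (k).
exact: Cf0.
Qed.

Lemma Ck_differentiable n p k (U : set 'rV[R]_n) (f : 'rV[R]_n -> 'rV[R]_p) :
  open U -> positive_order k -> Ck k U f -> forall x, U x -> differentiable f x.
Proof. by move=> oU k0 /(Ck_Cn1 oU k0) []. Qed.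

End CkCalculus.
Arguments CkP {R n p k U f}.
Arguments Ck_coordP {R n p k U f}.

Section CsMatrix.
Context {R : realType} {V : normedModType R}.

Lemma Cs_det m n (U : set V) (A : V -> 'M[R]_n) : open U ->
  (forall i j, Cs m U (fun x => A x i j)) -> Cs m U (fun x => \det (A x)).
Proof.
move=> oU CA; apply: Cs_sum => // s; apply: CsM => //; first exact: Cs_cst.
by apply: Cs_prod => // i; exact: CA.
Qed.

(** Cramer's formula: the entries of the inverse are polynomials in the
    entries divided by the determinant. *)
Lemma Cs_invmx m n (U : set V) (A : V -> 'M[R]_n) i j : open U ->
  (forall x, U x -> A x \in unitmx) ->
  (forall i j, Cs m U (fun x => A x i j)) ->
  Cs m U (fun x => invmx (A x) i j).
Proof.
move=> oU Au CA.
have Cadj : Cs m U (fun x => \adj (A x) i j).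
  apply: (@Cs_ext _ _ _ _ (fun x => cofactor (A x) j i)) => //.
    by move=> x _; rewrite mxE.
  apply: CsM => //; first exact: Cs_cst.
  apply: Cs_det => // a b.
  by apply: Cs_ext (CA (lift j a) (lift i b)) => // x _; rewrite !mxE.
have du x : U x -> \det (A x) != 0.
  by move=> /Au; rewrite unitmxE unitfE.
apply: Cs_ext (CsM oU (CsV oU du (Cs_det oU CA)) Cadj) => // x Ux.
by rewrite /invmx (Au _ Ux) !mxE.
Qed.

End CsMatrix.

(** * Compactly supported diffeomorphisms *)

Section CompactlySupportedDiffeos.
Context {R : realType} {n : nat}.
Implicit Types (k : smoothness) (U K : set 'rV[R]_n).
Implicit Types (P Q g : 'rV[R]_n -> 'rV[R]_n).

(** [P] and [Q] are mutually inverse diffeomorphisms of the whole space and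
    are trivial off a compact part of [U]. Globally defined maps compose
    without domain conditions. *)
Definition cdiff_pair k U P Q : Prop :=
  [/\ Ck k setT P, Ck k setT Q, cancel P Q, cancel Q P &
      exists K, [/\ compact K, K `<=` U & forall x, ~ K x -> P x = x]].

Definition cdiff k U P : Prop := exists Q, cdiff_pair k U P Q.

Lemma cdiff_pairC k U P Q : cdiff_pair k U P Q -> cdiff_pair k U Q P.
Proof.
case=> CP CQ PK QK [K [cK KU K0]]; split=> //.
by exists K; split=> // x /K0 Px; rewrite -{1}Px PK.
Qed.

Lemma cdiff_comp k U P Q : cdiff k U P -> cdiff k U Q -> cdiff k U (P \o Q).
Proof.
move=> [P' [CP CP' PK P'K [K [cK KU K0]]]].
move=> [Q' [CQ CQ' QK Q'K [L [cL LU L0]]]].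
exists (Q' \o P'); split.
- by apply: (Ck_comp (W := setT)) => //; exact: openT.
- by apply: (Ck_comp (W := setT)) => //; exact: openT.
- exact: can_comp.
- exact: can_comp.
- exists (K `|` L); split; first exact: compactU.
    by move=> x [/KU|/LU].
  by move=> x /not_orP[Kx Lx] /=; rewrite L0// K0.
Qed.

Lemma cdiff_id k U : cdiff k U id.
Proof.
exists id; split=> //; try by apply: Ck_id; exact: openT.
by exists set0; split => //; exact: compact0.
Qed.

Lemma cdiff_iter k U P m : cdiff k U P -> cdiff k U (iter m P).
Proof.
move=> dP; elim: m => [|m IH]; first exact: cdiff_id.
exact: (cdiff_comp dP IH).
Qed.

Lemma cdiff_sub k U U' P : U `<=` U' -> cdiff k U P -> cdiff k U' P.
Proof.
move=> UU' [Q [? ? ? ? [K [cK KU K0]]]]; exists Q; split=> //.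
by exists K; split=> // x /KU /UU'.
Qed.

Lemma cdiff_preserves k U P Q x : cdiff_pair k U P Q -> U x -> U (P x).
Proof.
move=> [_ _ PK QK [K [cK KU K0]]] Ux.
have [/KU//|/K0 e] := pselect (K (P x)).
by rewrite (can_inj PK e).
Qed.

End CompactlySupportedDiffeos.

(** * Small perturbations of the identity *)

HB.instance Definition _ (R : realType) m n := Complete.on 'M[R]_(m, n).

Lemma contraction_fixpoint (R : realType) n (f : 'rV[R]_n -> 'rV[R]_n) :
  (forall x y, `|f x - f y| <= 2^-1 * `|x - y|) -> exists p, f p = p.
Proof.
move=> f_lip; pose F : {fun [set: 'rV[R]_n] >-> [set: 'rV[R]_n]} :=
  [fun of totalfun f].
have ctr : is_contraction F.
  have h0 : (0 : R) <= 2^-1 by rewrite invr_ge0.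
  exists (NngNum h0); split => /=; first by rewrite invf_lt1// ltr1n.
  by move=> [a b] _ /=; rewrite /self_sub /= /totalfun_.
have [|p _ pF] := @banach_fixed_point R 'rV[R]_n setT F ctr (@closedT _).
  by exists 0.
by exists p; rewrite {2}pF.
Qed.

Section Perturbation.
Context {R : realType} {n : nat}.
Variables (u : 'rV[R]_n -> 'rV[R]_n).
Hypothesis u_lip : forall x y, `|u x - u y| <= 2^-1 * `|x - y|.

(** Solving x + u x = y means finding a fixed point of x |-> y - u x, a
    contraction. *)
Lemma perturbation_surjective y : exists x, x + u x = y.
Proof.
have [x x'|p pE] := contraction_fixpoint (f := fun x => y - u x).
  by rewrite opprB addrC addrA subrK distrC.
by exists p; rewrite -{1}pE subrK.
Qed.

Lemma perturbation_expands x y :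
  `|x - y| <= 2 * `|(x + u x) - (y + u y)|.
Proof.
have : `|x - y| <= `|(x + u x) - (y + u y)| + `|u x - u y|.
  rewrite -[X in `|X| <= _](_ : ((x + u x) - (y + u y)) - (u x - u y) = _).
    exact: ler_normB.
  by rewrite opprD addrACA -[u x - u y]opprK opprB addrK.
by move: (u_lip x y) => h1 h2; lra.
Qed.

Hypothesis u_diff : forall x, differentiable u x.

Definition perturbation_mx x : 'M[R]_n := 1%:M + jacobian u x.

(** The sharp bound is 1/2; any bound below 1 serves, and 3/4 is read off
    the definition of the derivative with error 1/4, without a limit. *)
Lemma diff_perturbation_le x v : `|'d u x v| <= (2^-1 + 4^-1) * `|v|.
Proof.
have [->|v0] := eqVneq v 0; first by rewrite linear0 normr0 mulr0.
have nv : 0 < `|v| by rewrite normr_gt0.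
have e0 : (0 : R) < 4^-1 by rewrite invr_gt0.
have /nbhs_normP[d /= d0 dP] := diff_estimate (u_diff x) e0.
(* a multiple of v short enough, of norm d / 2, to apply the estimate *)
pose t := d / (2 * `|v|).
have t0 : 0 < t by rewrite divr_gt0// mulr_gt0.
have tv : `|t *: v| = d / 2.
  by rewrite normrZ gtr0_norm// /t; field; rewrite normr_eq0.
have /dP : ball_ [eta Num.Def.normr] 0 d (t *: v).
  by rewrite /ball_ /= sub0r normrN tv ltr_pdivrMr// ltr_pMr// ltr1n.
rewrite linearZ /= => h.
rewrite -(ler_pM2l t0) mulrCA -{2}(gtr0_norm t0) -normrZ.
rewrite -[X in X * _](gtr0_norm t0) -normrZ mulrDl.
have -> : t *: 'd u x v = (u (t *: v + x) - u x) -
   (u (t *: v + x) - u x - t *: 'd u x v) by rewrite opprB addrC subrK.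
rewrite (le_trans (ler_normB _ _))// lerD//.
by rewrite (le_trans (u_lip _ _))// addrK.
Qed.

(** A vector killed by 1 + Du satisfies |v| = |Du v| <= 3/4 |v|. *)
Lemma perturbation_mx_unit x : perturbation_mx x \in unitmx.
Proof.
apply: unitmx_injective => v; rewrite mulmxDr mulmx1 mul_rV_lin1 /= => /eqP.
rewrite addr_eq0 => /eqP vE; have := diff_perturbation_le x v.
rewrite -normrN -vE => h; apply/eqP; rewrite -normr_le0 -(@pmulr_rle0 _ 4^-1).
  rewrite -[X in X * _](_ : 1 - (2^-1 + 4^-1) = 4^-1).
    by rewrite mulrBl mul1r subr_le0.
  by field.
by rewrite invr_gt0.
Qed.

Variable g : 'rV[R]_n -> 'rV[R]_n.
Hypothesis gK : forall y, g y + u (g y) = y.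

Lemma perturbation_inverse_lip y z : `|g y - g z| <= 2 * `|y - z|.
Proof. by have := perturbation_expands (g y) (g z); rewrite !gK. Qed.

(** With h an increment of y and k the increment of the inverse, h is
    k M + o(k); multiplying by the inverse of M and using |k| <= 2 |h| gives
    k = h M^-1 + o(h). *)
Lemma perturbation_inverse_diff y :
  is_diff y g (fun h => h *m invmx (perturbation_mx (g y))).
Proof.
set M := perturbation_mx (g y).
have Mu : M \in unitmx by exact: perturbation_mx_unit.
have [c c0 cM] := norm_mulmx_le (invmx M).
apply: (is_diff_of_estimate (L := mulmxr (invmx M))).
  exact: mulmx_continuous.
move=> e e0; pose e' := e / (2 * c).
have e'0 : 0 < e' by rewrite divr_gt0// mulr_gt0.
have /nbhs_normP[d /= d0 dP] := diff_estimate (u_diff (g y)) e'0.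
apply/nbhs_normP; exists (d / 2) => [|h /=]; first by rewrite /= divr_gt0.
rewrite sub0r normrN ltr_pdivlMr// mulrC => hd.
pose k := g (h + y) - g y.
have k2 : `|k| <= 2 * `|h|.
  by rewrite (le_trans (perturbation_inverse_lip _ _))// addrK.
have /dP : ball_ [eta Num.Def.normr] 0 d k.
  by rewrite /ball_ /= sub0r normrN (le_lt_trans k2).
rewrite {1}/k subrK; set r := (X in `|X| <= _) => rk.
have hE : h = k *m M + r.
  rewrite /M /perturbation_mx mulmxDr mulmx1 mul_rV_lin1 /= /r.
  rewrite -addrA [X in k + X]addrC subrK.
  have := gK (h + y); have := gK y; rewrite /k.
  move: (g (h + y)) (g y) (u (g (h + y))) (u (g y)) => a b ua ub.
  by move=> e1 e2; rewrite addrACA -opprD e1 e2 addrK.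
have -> : k - h *m invmx M = - (r *m invmx M).
  by rewrite hE mulmxDl mulmxK// opprD addrA subrr sub0r.
rewrite normrN (le_trans (cM _))// (le_trans (ler_wpM2l (ltW c0) rk))//.
rewrite (le_trans (ler_wpM2l (ltW c0) (ler_wpM2l (ltW e'0) k2)))//.
rewrite /e' le_eqVlt; apply/orP; left; apply/eqP; field.
by rewrite gt_eqF.
Qed.

(** The derivative of [g] at y is the inverse of 1 + Du at g y, so it is as
    smooth as Du and [g] are: the class of [g] can be raised one step at a
    time. *)
Lemma perturbation_inverse_Cn m : Cn m setT u -> Cn m setT g.
Proof.
have dg y : differentiable g y by have [] := perturbation_inverse_diff y.
elim: m => [_|m IH Cu].
  move=> x _; apply: (lipschitz_continuous (c := 2)) => //.
  exact: perturbation_inverse_lip.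
have Cg : Cn m setT g by apply: IH; apply: CnS Cu; exact: openT.
split=> // v; apply/(CnP openT) => i.
have CM a b : Cs m setT (fun y => perturbation_mx (g y) a b).
  have C1 : Cs m setT (fun x => perturbation_mx x a b).
    have := CsD openT (Cs_cst m setT ((1%:M : 'M[R]_n) a b))
      ((CnP openT).1 (Cu.2 (delta_mx 0 a)) b).
    apply: Cs_ext; first exact: openT.
    by move=> x _; rewrite /perturbation_mx !mxE deriveE.
  by apply: (Cs_comp (W := setT)) C1 Cg => //; exact: openT.
have Cinv a : Cs m setT
    (fun y => v 0 a * invmx (perturbation_mx (g y)) a i).
  apply: CsM; [exact: openT|exact: Cs_cst|].
  by apply: Cs_invmx => // [|x _]; [exact: openT|exact: perturbation_mx_unit].
apply: Cs_ext (Cs_sum (index_enum 'I_n) openT Cinv); first exact: openT.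
move=> y _; rewrite deriveE//.
have -> : 'd g y v = v *m invmx (perturbation_mx (g y)).
  by have [_ ->] := perturbation_inverse_diff y.
by rewrite mxE.
Qed.

End Perturbation.

(** The basic source of diffeomorphisms: a small Lipschitz perturbation of
    the identity is one, with no loss of smoothness. *)
Lemma cdiff_perturbation (R : realType) n k (U K : set 'rV[R]_n)
    (u : 'rV[R]_n -> 'rV[R]_n) :
  positive_order k -> Ck k setT u ->
  (forall x y, `|u x - u y| <= 2^-1 * `|x - y|) ->
  compact K -> K `<=` U -> (forall x, ~ K x -> u x = 0) ->
  cdiff k U (fun x => x + u x).
Proof.
move=> k0 Cu ulip cK KU K0.
have udiff x : differentiable u x by apply: (Ck_differentiable _ k0 Cu) => //; exact: openT.
have [g gK] := choice (perturbation_surjective ulip).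
exists g; split=> //.
- apply: CkD => //; [exact: openT|by apply: Ck_id; exact: openT].
- apply/(CkP openT) => m mk; apply: (perturbation_inverse_Cn ulip) => //.
  by move/(CkP openT) : Cu; apply.
- move=> x; apply/eqP; rewrite -subr_eq0 -normr_le0.
  rewrite (le_trans (perturbation_expands ulip _ _))//.
  by rewrite gK subrr normr0 mulr0.
- by exists K; split=> // x /K0 ->; rewrite addr0.
Qed.

(** * Smooth cut-off functions *)
Section FlatFunction.
Context {R : realType}.
Implicit Types (t : R) (j : nat).

(** Members of the family are t^-j exp(-1/t), extended by 0 to t <= 0. The
    family is closed under differentiation up to linear combinations, which
    turns smoothness of exp(-1/t) into an induction over all j at once. *)
Definition flat j t : R := if 0 < t then t^-1 ^+ j * expR (- t^-1) else 0.

Lemma flat_ge0 j t : 0 <= flat j t.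
Proof.
rewrite /flat; case: ifPn => // t0.
by rewrite mulr_ge0 ?expR_ge0// exprn_ge0// invr_ge0 ltW.
Qed.

(** With s = 1/t this is s^(j+2) <= (j+2)! exp s, one term of the exponential
    series. A quadratic bound at 0 gives differentiability there. *)
Lemma flat_bound j t : flat j t <= (j.+2)`!%:R * t ^+ 2.
Proof.
have f0 : (0 : R) < (j.+2)`!%:R by rewrite ltr0n fact_gt0.
rewrite /flat; case: ifPn => [t0|_]; last by rewrite mulr_ge0 ?sqr_ge0// ltW.
set s := t^-1; have s0 : 0 < s by rewrite invr_gt0.
have -> : t = s^-1 by rewrite invrK.
clearbody s => {t t0}.
rewrite expRN ler_pdivrMr ?expR_gt0// -mulrA -ler_pdivrMl//.
rewrite -(ler_pM2l (exprn_gt0 2 s0)) mulrCA -exprD addnC addn2.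
rewrite [leRHS]mulrA exprVn mulfV ?mul1r; last by rewrite gt_eqF ?exprn_gt0.
apply: le_trans (expR_ge1Dxn j.+1 (ltW s0)).
by rewrite [s ^+ _ / _]mulrC lerDr.
Qed.

Lemma is_diff_flat0 j : is_diff (0 : R) (flat j) (0 : R -> R).
Proof.
have f0 : (0 : R) < (j.+2)`!%:R by rewrite ltr0n fact_gt0.
apply: (is_diff_of_estimate (L := \0)); first by move=> x; exact: cvg_cst.
move=> e e0; apply/nbhs_normP.
exists (e / (j.+2)`!%:R) => [|h /=]; first by rewrite /= divr_gt0.
rewrite sub0r normrN addr0 {2}/flat ltxx subr0 subr0 => he.
rewrite ger0_norm ?flat_ge0// (le_trans (flat_bound _ _))//.
rewrite -[h ^+ 2]real_normK ?num_real// expr2 mulrA ler_wpM2r// ltW//.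
by rewrite mulrC -ltr_pdivlMr.
Qed.

Lemma is_derive_flat j t v :
  is_derive t v (flat j) (v * (flat j.+2 t - j%:R * flat j.+1 t)).
Proof.
suff [dt D1] : differentiable (flat j) t /\
    'D_1 (flat j) t = flat j.+2 t - j%:R * flat j.+1 t.
  apply: DeriveDef; first exact: diff_derivable.
  by rewrite deriveE// -[v in LHS]mulr1 [LHS]linearZ/= -D1 deriveE.
have [t0|t0|->] := ltgtP t 0.
- have ft : \forall s \near t, cst 0 s = flat j s.
    near=> s; rewrite /flat; case: ifPn => // s0; exfalso.
    suff : s < 0 by rewrite ltNge ltW.
    by near: s; exact: lt_nbhsl.
  split; first exact: near_eq_differentiable ft (differentiable_cst _ _).
  rewrite -(near_eq_derive _ ft) derive_cst /flat.
  by rewrite ltNge ltW//= mulr0 subr0.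
- pose F (s : R) := s^-1 ^+ j * expR (- s^-1).
  have ft : \forall s \near t, F s = flat j s.
    near=> s; rewrite /flat /F; case: ifPn => // /negP s0; exfalso.
    by apply: s0; near: s; exact: lt_nbhsr.
  have tN0 : t != 0 by rewrite gt_eqF.
  suff FD : is_derive t 1 F (flat j.+2 t - j%:R * flat j.+1 t).
    split; last by rewrite -(near_eq_derive _ ft) derive_val.
    apply: near_eq_differentiable ft _; apply/derivable1_diffP.
    by have [] := FD.
  have iD : is_derive t 1 (fun s : R => s^-1) (- t ^- 2).
    apply: DeriveDef; first exact: (derivableV (f := id)).
    by rewrite (deriveV (f := id))// derive_id [_ *: _]mulr1.
  have iE : is_derive t 1 (expR \o (fun s : R => - s^-1))
      (expR (- t^-1) * - (- t ^- 2)).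
    exact: is_derive1_comp.
  have iX := is_deriveX j iD.
  have iM := is_deriveM iX iE.
  rewrite (_ : F = (fun s : R => s^-1) ^+ j * (expR \o (fun s : R => - s^-1))).
    apply: is_derive_eq iM _.
    rewrite /flat t0 /= !fctE -![_ *: _]/(_ * _) -exprVn.
    move: (expR (- t^-1)) => E; move: (t^-1) => s; case: (j) => [|i] /=.
      by rewrite !mul0r mulr0 addr0 subr0 expr0 mul1r opprK mulrC.
    by rewrite !exprS; move: (s ^+ i) (i.+1%:R : R) => p q; ring.
  apply/funext => s; rewrite /F /=; congr (_ * _).
  by rewrite fctE.
- have [df dE] := is_diff_flat0 j; split=> //.
  by rewrite deriveE// dE /flat ltxx mulr0 subr0.
Unshelve. all: by end_near. Qed.

Lemma Cs_flat m j : Cs m setT (flat j).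
Proof.
have dfl i t : differentiable (flat i) t.
  by apply/derivable1_diffP; have [] := is_derive_flat i t 1.
elim: m j => [|m IH] j.
  by move=> t _; exact/differentiable_continuous.
split=> // v.
have := CsM openT (Cs_cst m setT v) (CsB openT (IH j.+2)
  (CsM openT (Cs_cst m setT j%:R) (IH j.+1))).
apply: Cs_ext; first exact: openT.
by move=> t _; have [_ ->] := is_derive_flat j t v.
Qed.

End FlatFunction.

Section Bump.
Context {R : realType}.

Lemma flat0_gt0 (t : R) : 0 < t -> 0 < flat 0 t.
Proof. by move=> t0; rewrite /flat t0 expr0 mul1r expR_gt0. Qed.

Lemma flat0_eq0 (t : R) : t <= 0 -> flat 0 t = 0.
Proof. by move=> t0; rewrite /flat ltNge t0. Qed.

(** A smooth transition from 1 on t <= 0 to 0 on t >= 1. The two flat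
    functions never vanish together. *)
Definition step (t : R) : R := flat 0 (1 - t) / (flat 0 (1 - t) + flat 0 t).

Lemma step_den_gt0 (t : R) : 0 < flat 0 (1 - t) + flat 0 t.
Proof.
have [t0|t0] := leP t 0.
  by rewrite ltr_wpDr ?flat_ge0// flat0_gt0// subr_gt0 (le_lt_trans t0).
by rewrite ltr_wpDl ?flat_ge0// flat0_gt0.
Qed.

Lemma step1 t : t <= 0 -> step t = 1.
Proof.
move=> t0; rewrite /step (flat0_eq0 t0) addr0 divff// gt_eqF// flat0_gt0//.
by rewrite subr_gt0 (le_lt_trans t0).
Qed.

Lemma step0 t : 1 <= t -> step t = 0.
Proof. by move=> t1; rewrite /step flat0_eq0 ?mul0r// subr_le0. Qed.

Lemma step_itv t : 0 <= step t <= 1.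
Proof.
rewrite /step divr_ge0 ?(ltW (step_den_gt0 _)) ?flat_ge0//=.
by rewrite ler_pdivrMr ?step_den_gt0// mul1r lerDl flat_ge0.
Qed.

Lemma Cs_id m (U : set R) : Cs m U id.
Proof.
case: m => [|m]; first by move=> t _; exact: cvg_id.
split=> [t _|v]; first exact: ex_diff.
have -> : (fun t : R => 'D_v id t) = fun=> v; last exact: Cs_cst.
by apply/funext => t; rewrite derive_id.
Qed.

Lemma Cs_step m : Cs m setT step.
Proof.
have C1 : Cs m setT (fun t : R => flat 0 (1 - t)).
  apply: (Cs_comp1 (W := setT) (f := flat 0)) => //; try exact: openT.
    exact: Cs_flat.
  by apply: CsB; [exact: openT|exact: Cs_cst|exact: Cs_id].
apply: CsM => //; first exact: openT.
apply: CsV; first exact: openT.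
  by move=> t _; rewrite gt_eqF// step_den_gt0.
by apply: CsD => //; [exact: openT|exact: Cs_flat].
Qed.

(** The square of the Euclidean norm: a polynomial, hence smooth, unlike the
    norms themselves. *)
Definition sqnorm n (x : 'rV[R]_n) : R := \sum_(i < n) x 0 i ^+ 2.

Lemma sqnorm_ge0 n (x : 'rV[R]_n) : 0 <= sqnorm x.
Proof. by apply: sumr_ge0 => i _; exact: sqr_ge0. Qed.

Lemma sqnorm0 n : sqnorm (0 : 'rV[R]_n) = 0.
Proof. by apply: big1 => i _; rewrite mxE expr0n. Qed.

Lemma Cs_sqnorm n m (U : set 'rV[R]_n) : open U -> Cs m U (@sqnorm n).
Proof.
move=> oU; apply: Cs_sum => // i.
apply: (Cs_ext (f := fun x : 'rV[R]_n => x 0 i * x 0 i)) => //.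
by apply: CsM => //; exact: Cs_coord.
Qed.

Lemma sqnorm_continuous n : continuous (@sqnorm n).
Proof. by move=> x; apply: (Cs_continuous (Cs_sqnorm 0 openT)). Qed.

Lemma coord_sqnorm n (x : 'rV[R]_n) i : `|x 0 i| ^+ 2 <= sqnorm x.
Proof.
rewrite real_normK ?num_real// /sqnorm (bigD1 i)//= lerDl sumr_ge0// => j _.
exact: sqr_ge0.
Qed.

Lemma norm_sqnorm n (x : 'rV[R]_n) : `|x| ^+ 2 <= sqnorm x.
Proof.
rewrite -[leRHS]sqr_sqrtr ?sqnorm_ge0// ler_sqr ?nnegrE ?sqrtr_ge0//.
apply: norm_row_le => [|i]; first exact: sqrtr_ge0.
by rewrite -(ler_sqr) ?nnegrE ?sqrtr_ge0// sqr_sqrtr ?sqnorm_ge0// coord_sqnorm.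
Qed.

Lemma compact_sqnorm_le n (r : R) : compact [set x : 'rV[R]_n | sqnorm x <= r].
Proof.
apply: bounded_closed_compact.
  exists (1 + `|r|); split; first exact: num_real.
  move=> M rM x /= xr; apply: le_trans (ltW rM).
  have nx := normr_ge0 x; have := norm_sqnorm x; have := ler_norm r.
  by move=> h1 h2; nra.
apply: (closed_comp (f := @sqnorm n) (D := [set t : R | t <= r])).
  by move=> x _; exact: sqnorm_continuous.
exact: closed_le.
Qed.

Lemma open_sqnorm_lt n (r : R) : open [set x : 'rV[R]_n | sqnorm x < r].
Proof.
apply: (open_comp (f := @sqnorm n) (D := [set t : R | t < r])).
  by move=> x _; exact: sqnorm_continuous.
exact: open_lt.
Qed.

Definition bump n (s r : R) (x : 'rV[R]_n) : R :=
  step ((sqnorm x - s) / (r - s)).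

Lemma bump1 n s r (x : 'rV[R]_n) : s < r -> sqnorm x <= s -> bump s r x = 1.
Proof.
by move=> sr xs; apply: step1; rewrite pmulr_lle0 ?invr_gt0 ?subr_gt0// subr_le0.
Qed.

Lemma bump0 n s r (x : 'rV[R]_n) : s < r -> r <= sqnorm x -> bump s r x = 0.
Proof.
by move=> sr xs; apply: step0; rewrite ler_pdivlMr ?subr_gt0// mul1r lerB.
Qed.

Lemma bump_itv n s r (x : 'rV[R]_n) : 0 <= bump s r x <= 1.
Proof. exact: step_itv. Qed.

Lemma Cs_bump n s r m : Cs m setT (@bump n s r).
Proof.
apply: (Cs_comp1 (W := setT) (f := step)) => //; try exact: openT.
  exact: Cs_step.
apply: CsM; [exact: openT| |exact: Cs_cst].
by apply: CsB; [exact: openT|apply: Cs_sqnorm; exact: openT|exact: Cs_cst].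
Qed.

End Bump.

(** * Lipschitz estimates *)
Section MeanValue.
Context {R : realType}.

(** The mean value theorem along the segment. The factor n comes from
    expanding the direction in the standard basis. *)
Lemma mean_value_le n (f : 'rV[R]_n -> R) (x y : 'rV[R]_n) (M : R) :
  (forall t : R, 0 <= t <= 1 -> differentiable f (y + t *: (x - y)) /\
     forall j, `|'D_(delta_mx 0 j) f (y + t *: (x - y))| <= M) ->
  `|f x - f y| <= n%:R * M * `|x - y|.
Proof.
move=> fM; pose l (t : R) := y + t *: (x - y).
pose df t := 'd f (l t) (x - y).
have lD (t : R) : is_diff t l (fun s => s *: (x - y)).
  have := is_diffD (is_diff_cst y t) (is_diff_scalel t (x - y)).
  by rewrite add0r.
have fl (t : R) : 0 <= t <= 1 -> is_diff t (f \o l) (fun s => 'd f (l t) (s *: (x - y))).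
  move=> t01; have [ft _] := fM t t01.
  have := is_diff_comp (lD t) (differentiableP ft).
  exact.
have fd (t : R) : t \in `]0, 1[ -> is_derive t 1 (f \o l) (df t).
  rewrite in_itv/= => /andP[t0 t1].
  have t01 : 0 <= t <= 1 by rewrite !ltW.
  have [d1 d2] := fl t t01; apply: DeriveDef; first exact: diff_derivable.
  by rewrite deriveE// d2 scale1r.
have fc : {within `[0, 1], continuous (f \o l)}.
  apply: continuous_in_subspaceT => t; rewrite inE/= in_itv/= => t01.
  by apply: differentiable_continuous; have [] := fl t t01.
have [c] := MVT_segment ler01 fd fc.
have l1 : l 1 = x by rewrite /l scale1r addrC subrK.
have l0 : l 0 = y by rewrite /l scale0r addr0.
rewrite in_itv/= => c01; rewrite /= l1 l0 subr0 mulr1 => ->.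
have [fdc fMc] := fM c c01.
rewrite /df [X in 'd f _ X]row_sum_delta linear_sum.
rewrite (le_trans (ler_norm_sum _ _ _))//.
rewrite -mulrA mulr_natl -[X in _ *+ X](card_ord n) -sumr_const.
apply: ler_sum => i _; rewrite linearZ/= normrM mulrC ler_pM// ?coord_le_norm//.
by rewrite -deriveE.
Qed.

(** The partial derivatives are continuous and vanish off a compact set, so
    they are bounded. *)
Lemma compact_support_lipschitz n p (K : set 'rV[R]_n) (u : 'rV[R]_n -> 'rV[R]_p) :
  Cn 1 setT u -> compact K -> (forall x, ~ K x -> u x = 0) ->
  exists2 L, 0 < L & forall x y, `|u x - u y| <= L * `|x - y|.
Proof.
move=> [ud uD] cK K0.
have DK v x : ~ K x -> 'D_v u x = 0.
  move=> Kx; have nu : \forall y \near x, cst 0 y = u y.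
    have oK : open (~` K).
      by apply: closed_openC; apply: compact_closed => //; exact: norm_hausdorff.
    by apply: filterS (open_nbhs_nbhs (conj oK Kx)) => y /K0.
  by rewrite -(near_eq_derive _ nu) derive_cst.
have DM j : exists2 M, 0 <= M & forall x, `|'D_(delta_mx 0 j) u x| <= M.
  have cD : compact ('D_(delta_mx 0 j) u @` K).
    apply: continuous_compact => //; apply: continuous_subspaceT => x.
    exact: uD.
  have [N [_ NP]] := compact_bounded cD.
  exists (`|N| + 1) => [|x]; first by rewrite addr_ge0.
  have [Kx|/DK->] := pselect (K x); last by rewrite normr0 addr_ge0.
  by apply: NP; [rewrite ltr_pwDr// ler_norm|exists x].
have [M M0 MP] : exists2 M, 0 <= M & forall j x, `|'D_(delta_mx 0 j) u x| <= M.
  have /choice[Mf MfP] j : exists M, 0 <= M /\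
      forall x, `|'D_(delta_mx 0 j) u x| <= M.
    by have [M M0 MP] := DM j; exists M.
  exists (\sum_j Mf j) => [|j x].
    by apply: sumr_ge0 => j _; have [] := MfP j.
  rewrite (bigD1 j)//= (le_trans ((MfP j).2 x))// lerDl.
  by apply: sumr_ge0 => i _; have [] := MfP i.
exists (n%:R * M + 1) => [|x y]; first by rewrite ltr_wpDl// mulr_ge0.
apply: norm_row_le => [|i]; first by rewrite mulr_ge0// addr_ge0// mulr_ge0.
have -> : (u x - u y) 0 i = u x 0 i - u y 0 i by rewrite !mxE.
apply: (@le_trans _ _ (n%:R * M * `|x - y|)); last first.
  by rewrite ler_wpM2r// lerDl.
apply: (mean_value_le (f := fun x => u x 0 i)) => t _; split.
  have := ud (y + t *: (x - y)) I.
  by move/differentiable_rowP.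
move=> j; rewrite -derive_rowE; last exact: ud.
by rewrite (le_trans (coord_le_norm _ _)).
Qed.

End MeanValue.

(** A field need not be small: a small multiple of it has Lipschitz constant
    at most 1/2. *)
Lemma cdiff_small (R : realType) n k (U K : set 'rV[R]_n)
    (u : 'rV[R]_n -> 'rV[R]_n) :
  positive_order k -> Ck k setT u -> compact K -> K `<=` U ->
  (forall x, ~ K x -> u x = 0) ->
  exists2 eta, 0 < eta & forall s, `|s| <= eta -> cdiff k U (fun x => x + s *: u x).
Proof.
move=> k0 Cu cK KU K0.
have [L L0 Lu] := compact_support_lipschitz (Ck_Cn1 openT k0 Cu) cK K0.
exists (2^-1 / L) => [|s sL]; first by rewrite divr_gt0// invr_gt0.
apply: (cdiff_perturbation (K := K)) => //.
- by apply: Ck_scale => //; [exact: openT|move=> m _; exact: Cs_cst].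
- move=> x y; rewrite -scalerBr normrZ.
  rewrite (le_trans (ler_wpM2l (normr_ge0 s) (Lu x y)))// mulrA ler_wpM2r//.
  by rewrite -ler_pdivlMr.
- by move=> x /K0 ->; rewrite scaler0.
Qed.

(** * Conjugating compactly supported diffeomorphisms *)
Section Transport.
Context {R : realType} {n : nat}.
Implicit Types (k : smoothness) (U V W : set 'rV[R]_n).

Lemma Ck_diffeo_inverse k W V (phi : 'rV[R]_n -> 'rV[R]_n) :
  Ck_diffeo k W V phi -> exists psi, [/\ Ck k V psi,
    forall x, W x -> V (phi x) /\ psi (phi x) = x &
    forall y, V y -> W (psi y) /\ phi (psi y) = y].
Proof.
move=> [oW oV <- Cphi [psi [Cpsi psiK]]]; exists psi; split=> //.
  by move=> x Wx; split; [exists x|exact: psiK].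
by move=> _ [x Wx <-]; rewrite psiK.
Qed.

Section Conjugate.
Variables (k : smoothness) (W V : set 'rV[R]_n) (phi psi : 'rV[R]_n -> 'rV[R]_n).
Hypotheses (oW : open W) (oV : open V) (Cphi : Ck k W phi) (Cpsi : Ck k V psi).
Hypothesis phiK : forall x, W x -> V (phi x) /\ psi (phi x) = x.
Hypothesis psiK : forall y, V y -> W (psi y) /\ phi (psi y) = y.

(** The map phi o P o psi on [V], extended by the identity. When P is trivial
    off a compact subset K of W, the extension is smooth, since V and the
    complement of the compact set phi(K) are open and cover the space. *)
Definition conjugate (P : 'rV[R]_n -> 'rV[R]_n) (y : 'rV[R]_n) : 'rV[R]_n :=
  if y \in V then phi (P (psi y)) else y.

Lemma conjugateE P z : W z -> conjugate P (phi z) = phi (P z).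
Proof.
by move=> Wz; have [Vz e] := phiK Wz; rewrite /conjugate mem_set// e.
Qed.

Lemma conjugate_id P K y : (forall x, ~ K x -> P x = x) ->
  ~ (phi @` K) y -> conjugate P y = y.
Proof.
move=> K0 Ky; rewrite /conjugate; case: ifPn => // /set_mem Vy.
rewrite K0; first by have [] := psiK Vy.
by move=> Kp; apply: Ky; exists (psi y) => //; have [] := psiK Vy.
Qed.

Lemma compact_image K : compact K -> K `<=` W -> compact (phi @` K).
Proof.
move=> cK KW; apply: continuous_compact => //.
apply: continuous_in_subspaceT => x /set_mem /KW Wx.
exact: (Ck_continuous oW Cphi Wx).
Qed.

Lemma conjugate_Ck P Q : cdiff_pair k W P Q -> Ck k setT (conjugate P).
Proof.
move=> PQ; have [CP _ _ _ [K [cK KW K0]]] := PQ.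
have oK : open (~` (phi @` K)).
  apply: closed_openC; apply: compact_closed; first exact: norm_hausdorff.
  exact: compact_image.
have -> : setT = V `|` ~` (phi @` K).
  rewrite eqEsubset; split => // y _.
  have [[x Kx <-]|] := pselect ((phi @` K) y); last by right.
  by left; have [] := phiK (KW _ Kx).
apply: CkU => //.
  apply: (Ck_ext (f := phi \o P \o psi)) => //.
    by move=> y Vy; rewrite /conjugate mem_set.
  apply: (Ck_comp (W := W)) => //; first by move=> y /psiK[].
  apply: (Ck_comp (W := W)) => //; first by move=> x; exact: cdiff_preserves PQ.
  by apply: Ck_sub CP => //; exact: openT.
apply: (Ck_ext (f := id)) => //; last exact: Ck_id.
by move=> y /(conjugate_id K0).
Qed.

Lemma conjugateK P Q : cdiff_pair k W P Q ->
  cancel (conjugate P) (conjugate Q).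
Proof.
move=> PQ y; have [_ _ PK _ _] := PQ.
have [Vy|Vy] := pselect (V y).
  have [Wy <-] := psiK Vy.
  rewrite conjugateE// conjugateE ?PK//.
  exact: cdiff_preserves PQ _.
by rewrite /conjugate memNset// memNset.
Qed.

Lemma cdiff_conjugate U P : U `<=` W -> cdiff k U P ->
  cdiff k (phi @` U) (conjugate P).
Proof.
move=> UW [Q PQU].
have PQ : cdiff_pair k W P Q.
  have [? ? ? ? [K [cK KU K0]]] := PQU; split=> //.
  by exists K; split=> // x /KU /UW.
exists (conjugate Q); split.
- exact: conjugate_Ck PQ.
- exact: conjugate_Ck (cdiff_pairC PQ).
- exact: conjugateK PQ.
- exact: conjugateK (cdiff_pairC PQ).
have [_ _ _ _ [K [cK KU K0]]] := PQU.
exists (phi @` K); split.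
- by apply: compact_image => // x /KU /UW.
- exact: image_subset.
- by move=> y /(conjugate_id K0).
Qed.

End Conjugate.

Lemma cdiff_transport k U W V phi P : Ck_diffeo k W V phi -> U `<=` W ->
  cdiff k U P -> exists2 P', cdiff k (phi @` U) P' &
    forall z, W z -> P' (phi z) = phi (P z).
Proof.
move=> Dphi UW dP; have [psi [Cpsi phiK psiK]] := Ck_diffeo_inverse Dphi.
have [oW oV _ Cphi _] := Dphi.
exists (conjugate V phi psi P); first exact: (cdiff_conjugate (W := W)).
by move=> z Wz; exact: (conjugateE phiK).
Qed.

End Transport.

(** * Matrices of positive determinant are products of elementary ones *)
Section PositiveDeterminant.
Context {R : realFieldType}.

(** Adding multiples of the first row to the others is left multiplication
    by a lower shear, and adding multiples of the others to the first is left
    multiplication by an upper one. *)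
Definition lower_shear n (c : 'cV[R]_n) : 'M[R]_(1 + n) := block_mx 1%:M 0 c 1%:M.
Definition upper_shear n (r : 'rV[R]_n) : 'M[R]_(1 + n) := block_mx 1%:M r 0 1%:M.

Lemma lower_shearD n (c c' : 'cV[R]_n) :
  lower_shear (c + c') = lower_shear c *m lower_shear c'.
Proof.
rewrite /lower_shear mulmx_block !mul1mx !mulmx1 !mul0mx !mulmx0 !addr0 add0r.
by [].
Qed.

Lemma upper_shearD n (r r' : 'rV[R]_n) :
  upper_shear (r + r') = upper_shear r *m upper_shear r'.
Proof.
rewrite /upper_shear mulmx_block !mul1mx !mulmx1 !mul0mx !mulmx0 !addr0 !add0r.
by rewrite [r + r']addrC.
Qed.

Lemma lower_shear0 n : lower_shear (0 : 'cV[R]_n) = 1%:M.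
Proof. by rewrite /lower_shear -scalar_mx_block. Qed.

Lemma upper_shear0 n : upper_shear (0 : 'rV[R]_n) = 1%:M.
Proof. by rewrite /upper_shear -scalar_mx_block. Qed.

Lemma det_lower_shear n (c : 'cV[R]_n) : \det (lower_shear c) = 1.
Proof. by rewrite /lower_shear det_lblock !det1 mulr1. Qed.

Lemma det_upper_shear n (r : 'rV[R]_n) : \det (upper_shear r) = 1.
Proof. by rewrite /upper_shear det_ublock !det1 mulr1. Qed.

Definition elementary_closed n (P : 'M[R]_n -> Prop) : Prop :=
  [/\ P 1%:M, (forall A B, P A -> P B -> P (A *m B)),
      (forall i j c, i != j -> P (1%:M + c *: delta_mx i j)) &
      (forall i d, 0 < d -> P (1%:M + (d - 1) *: delta_mx i i))].

Lemma elementary_lower_shear n (P : 'M[R]_(1 + n) -> Prop) c :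
  elementary_closed P -> P (lower_shear c).
Proof.
move=> [P1 PM PE _]; rewrite (matrix_sum_delta c).
elim/big_rec : _ => [|i x _ Px]; first by rewrite lower_shear0.
rewrite lower_shearD big_ord1; apply: PM => //.
have -> : lower_shear (c i 0 *: delta_mx i 0) =
    1%:M + c i 0 *: delta_mx (rshift 1 i) (lshift n 0).
  rewrite /lower_shear; apply/matrixP => a b; rewrite -(splitK a) -[b]splitK.
  case: (fintype.split a) (fintype.split b) => a' [] b' /=; rewrite ?(block_mxEul, block_mxEur,
    block_mxEdl, block_mxEdr) !mxE ?(eq_lshift, eq_rshift, eq_lrshift,
    eq_rlshift) ?ord1 ?andbF ?mulr0 ?addr0 ?add0r //=.
by apply: PE; rewrite eq_sym eq_lrshift.
Qed.

Lemma elementary_upper_shear n (P : 'M[R]_(1 + n) -> Prop) r :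
  elementary_closed P -> P (upper_shear r).
Proof.
move=> [P1 PM PE _]; rewrite (row_sum_delta r).
elim/big_rec : _ => [|i x _ Px]; first by rewrite upper_shear0.
rewrite upper_shearD; apply: PM => //.
have -> : upper_shear (r 0 i *: delta_mx 0 i) =
    1%:M + r 0 i *: delta_mx (lshift n 0) (rshift 1 i).
  rewrite /upper_shear; apply/matrixP => a b; rewrite -(splitK a) -[b]splitK.
  case: (fintype.split a) (fintype.split b) => a' [] b' /=; rewrite ?(block_mxEul, block_mxEur,
    block_mxEdl, block_mxEdr) !mxE ?(eq_lshift, eq_rshift, eq_lrshift,
    eq_rlshift) ?ord1 ?andbF ?mulr0 ?addr0 ?add0r //=.
by apply: PE; rewrite eq_lrshift.
Qed.

(** The hypothesis passes to the lower right block; this feeds the induction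
    on the size. *)
Lemma elementary_minor n (P : 'M[R]_(1 + n) -> Prop) :
  elementary_closed P ->
  elementary_closed (fun B : 'M[R]_n => P (block_mx (1%:M : 'M[R]_1) 0 0 B)).
Proof.
move=> [P1 PM PE PD].
have E i j c : block_mx (1%:M : 'M[R]_1) 0 0 (1%:M + c *: delta_mx i j) =
    1%:M + c *: delta_mx (rshift 1 i) (rshift 1 j) :> 'M[R]_(1 + n).
  apply/matrixP => a b; rewrite -(splitK a) -[b]splitK.
  case: (fintype.split a) (fintype.split b) => a' [] b' /=; rewrite ?(block_mxEul, block_mxEur,
    block_mxEdl, block_mxEdr) !mxE ?(eq_lshift, eq_rshift, eq_lrshift,
    eq_rlshift) ?ord1 ?andbF ?mulr0 ?addr0 ?add0r //=.
split=> [|A B PA PB|i j c ij|i d d0].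
- by rewrite -scalar_mx_block.
- have -> : block_mx (1%:M : 'M[R]_1) 0 0 (A *m B) =
      block_mx (1%:M : 'M[R]_1) 0 0 A *m block_mx (1%:M : 'M[R]_1) 0 0 B.
    by rewrite mulmx_block !mul1mx !mul0mx !mulmx0 !addr0 add0r.
  exact: PM.
- by rewrite E; apply: PE; rewrite eq_rshift.
- by rewrite E; exact: PD.
Qed.

(** Gaussian elimination. A matrix with upper left entry 1 is a lower shear
    times a block diagonal matrix times an upper shear. That entry is made 1 by
    adding to the first row a multiple of another row with nonzero first entry;
    if there is none, the first row is first added to the second. Only shears
    are used, so the determinant stays positive down to size 1. *)
Lemma elementary_generate n (P : 'M[R]_n -> Prop) :
  elementary_closed P -> forall A, 0 < \det A -> P A.
Proof.
elim: n P => [|n IH] P PP A dA.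
  by rewrite (flatmx0 A) -(flatmx0 1%:M); have [] := PP.
have [P1 PM PE PD] := PP.
have Plo := elementary_lower_shear _ PP.
have Pup := elementary_upper_shear _ PP.
have corner1 (B : 'M[R]_(1 + n)) : 0 < \det B -> B 0 0 = 1 -> P B.
  move=> dB B1.
  pose C := drsubmx B - dlsubmx B *m ursubmx B.
  have BE : B = lower_shear (dlsubmx B) *m block_mx (1%:M : 'M[R]_1) 0 0 C *m
      upper_shear (ursubmx B).
    rewrite /lower_shear /upper_shear !mulmx_block !mul1mx !mulmx1 !mul0mx.
    rewrite !mulmx0 !addr0 !add0r mul1mx -[LHS]submxK; congr block_mx.
      by apply/matrixP => i j; rewrite !ord1 !mxE lshift0 B1.
    by rewrite /C addrC subrK.
  rewrite BE; apply: (PM) => //; apply: (PM) => //.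
  apply: (IH _ (elementary_minor PP)).
  move: dB; rewrite {1}BE !det_mulmx det_lower_shear det_upper_shear.
  by rewrite mul1r mulr1 (det_ublock (1%:M : 'M[R]_1)) det1 mul1r.
have below (B : 'M[R]_(1 + n)) : 0 < \det B ->
    (exists i : 'I_n, B (rshift 1 i) 0 != 0) -> P B.
  move=> dB [i Bi].
  (* the multiple of row i that turns the corner entry into 1 *)
  pose r : 'rV[R]_n := ((1 - B 0 0) / B (rshift 1 i) 0) *: delta_mx 0 i.
  have -> : B = upper_shear (- r) *m (upper_shear r *m B).
    by rewrite mulmxA -upper_shearD addNr upper_shear0 mul1mx.
  apply: (PM) => //; apply: corner1.
    by rewrite det_mulmx det_upper_shear mul1r.
  have e0 : (0 : 'I_(1 + n)) = lshift n 0 by apply: val_inj.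
  rewrite mxE big_split_ord /= big_ord1 (bigD1 i)//= big1 => [|j ji].
    rewrite e0 /upper_shear block_mxEul block_mxEur !mxE !eqxx mulr1 addr0.
    by rewrite -e0 divfK// mul1r addrC subrK.
  by rewrite e0 /upper_shear block_mxEur !mxE (negbTE ji) andbF mulr0 mul0r.
case: (pselect (exists i : 'I_n, A (rshift 1 i) 0 != 0)) => [/below|H]; first exact.
have A0 (i : 'I_n) : A (rshift 1 i) 0 = 0.
  by apply/eqP; apply: contra_notT H => Ai; exists i.
case: n {IH} P PP A dA P1 PM PE PD Plo Pup corner1 below H A0 => [|n] P PP A dA.
  move=> P1 PM PE PD Plo Pup corner1 below H A0.
  have -> : A = 1%:M + (\det A - 1) *: delta_mx 0 0.
    by rewrite det_mx11; apply/matrixP => i j; rewrite !ord1 !mxE/= mulr1 addrC subrK.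
  exact: PD.
move=> P1 PM PE PD Plo Pup corner1 below H A0.
pose c : 'cV[R]_n.+1 := delta_mx 0 0.
have -> : A = lower_shear (- c) *m (lower_shear c *m A).
  by rewrite mulmxA -lower_shearD addNr lower_shear0 mul1mx.
apply: (PM) => //; apply: below.
  by rewrite det_mulmx det_lower_shear mul1r.
have e0 : (0 : 'I_(1 + n.+1)) = lshift n.+1 0 by apply: val_inj.
exists 0; rewrite mxE big_split_ord /= big_ord1 big1 => [|j _].
  rewrite /lower_shear block_mxEdl !mxE !eqxx mul1r addr0 -e0.
  apply/negP => /eqP A00; move: dA; rewrite (expand_det_col _ 0).
  rewrite big1 ?ltxx// => j _; rewrite -(@splitK 1 n.+1 j).
  case: (@fintype.split 1 n.+1 j) => j' /=; last by rewrite A0 mul0r.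
  by rewrite ord1 -e0 A00 mul0r.
by rewrite A0 mulr0.
Qed.

End PositiveDeterminant.

(** * Model diffeomorphisms: shrinking and translating *)
Section Models.
Context {R : realType} {n : nat}.
Implicit Types (k : smoothness) (U : set 'rV[R]_n) (x p q : 'rV[R]_n).

Lemma eball0E (r : R) : 0 < r ->
  eball (0 : 'rV[R]_n) r = [set x | sqnorm x < r ^+ 2].
Proof.
move=> r0; apply/seteqP; split=> x; rewrite /eball /= subr0 /enorm -/(sqnorm x).
  move=> h; rewrite -[sqnorm x]sqr_sqrtr ?sqnorm_ge0//.
  by rewrite ltr_sqr ?nnegrE ?sqrtr_ge0// ltW.
by move=> h; rewrite -ltr_sqr ?nnegrE ?sqrtr_ge0 ?(ltW r0)// sqr_sqrtr ?sqnorm_ge0.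
Qed.

Lemma closed_eball0E : closed_eball (0 : 'rV[R]_n) 1 = [set x | sqnorm x <= 1].
Proof.
apply/seteqP; split=> x; rewrite /closed_eball /= subr0 /enorm -/(sqnorm x).
  by rewrite -{1}(sqrtr1 R) ler_sqrt.
by rewrite -{2}(sqrtr1 R) ler_sqrt.
Qed.

Lemma open_eball0 (r : R) : 0 < r -> open (eball (0 : 'rV[R]_n) r).
Proof. by move=> /eball0E ->; exact: open_sqnorm_lt. Qed.

(** A single small step multiplies the unit ball by 1 - s, and its iterates
    multiply it by powers of 1 - s, which become as small as needed. The unit
    ball is mapped into itself, so each step acts there by the same formula. *)
Lemma cdiff_shrink k (e d : R) : positive_order k -> 0 < e -> 0 < d ->
  exists c, [/\ 0 < c, c < d & exists2 P,
    cdiff k (eball (0 : 'rV[R]_n) (1 + e)) P &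
    forall x, sqnorm x <= 1 -> P x = c *: x].
Proof.
move=> k0 e0 d0.
pose u x := bump 1 (1 + e) x *: x.
have e1 : 1 < 1 + e by rewrite ltrDl.
have Cu : Ck k setT u.
  by apply: Ck_scale; [exact: openT|move=> m _; exact: Cs_bump|apply: Ck_id; exact: openT].
have KU : [set x | sqnorm x <= 1 + e] `<=` eball (0 : 'rV[R]_n) (1 + e).
  rewrite eball0E; last by rewrite addr_gt0.
  by move=> x /= /le_lt_trans; apply; rewrite expr2 ltr_pMl// addr_gt0.
have u0 x : ~ sqnorm x <= 1 + e -> u x = 0.
  by move=> /negP; rewrite -ltNge => /ltW h; rewrite /u bump0 ?scale0r.
have [eta eta0 etaP] := cdiff_small k0 Cu (@compact_sqnorm_le R n (1 + e)) KU u0.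
pose s := Num.min eta (1 / 2).
have s0 : 0 < s by rewrite lt_min eta0 divr_gt0.
have s2 : s <= 1 / 2 by rewrite ge_min lexx orbT.
have dP : cdiff k (eball 0 (1 + e)) (fun x => x + (- s) *: u x).
  by apply: etaP; rewrite normrN gtr0_norm// ge_min lexx.
have c0 : 0 < 1 - s by lra.
have c1 : 1 - s < 1 by lra.
have Pc m x : sqnorm x <= 1 ->
    iter m (fun x => x + (- s) *: u x) x = (1 - s) ^+ m *: x.
  move=> x1; elim: m => [|m IH]; first by rewrite expr0 scale1r.
  rewrite iterS IH /u bump1 ?scale1r//.
    by rewrite -[X in X + _]scale1r -scalerDl scalerA exprS.
  apply: le_trans x1; rewrite /sqnorm; apply: ler_sum => i _; rewrite mxE exprMn.
  rewrite ler_piMl ?sqr_ge0// -exprM exprn_ile1//; first exact: ltW.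
  exact: ltW.
have [m md] : exists m, (1 - s) ^+ m < d.
  have /cvgrPdist_lt/(_ _ d0)[N _ NP] : (1 - s) ^+ m @[m --> \oo] --> (0 : R).
    by apply: cvg_expr; rewrite gtr0_norm.
  exists N; have := NP N (leqnn N); rewrite /= sub0r normrN.
  by apply: le_lt_trans; exact: ler_norm.
exists ((1 - s) ^+ m); split => //; first by rewrite exprn_gt0.
by exists (iter m (fun x => x + (- s) *: u x)); [exact: cdiff_iter|exact: Pc].
Qed.

Lemma sqnorm_segment x y (t : R) : 0 <= t <= 1 ->
  sqnorm (x + t *: (y - x)) <= (1 - t) * sqnorm x + t * sqnorm y.
Proof.
move=> /andP[t0 t1]; rewrite /sqnorm !mulr_sumr -big_split /=.
apply: ler_sum => i _; rewrite !mxE.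
move: (x 0 i) (y 0 i) => a b; rewrite -subr_ge0.
have -> : (1 - t) * a ^+ 2 + t * b ^+ 2 - (a + t * (b - a)) ^+ 2 =
  t * (1 - t) * (a - b) ^+ 2 by ring.
by rewrite mulr_ge0 ?sqr_ge0// mulr_ge0// subr_ge0.
Qed.

(** The field is the constant q - p cut off outside a ball that contains the
    segment from p to q; N steps of size 1/N follow this segment. The same is
    true of points near p, so the map is a translation there and has Jacobian
    matrix 1 at p. *)
Lemma cdiff_translate k p q : positive_order k ->
  eball 0 1 p -> eball 0 1 q ->
  exists2 P, cdiff k (eball 0 1) P & \forall x \near p, P x = x + (q - p).
Proof.
move=> k0; rewrite !eball0E// expr1n /= => p1 q1.
pose a := (Num.max (sqnorm p) (sqnorm q) + 1) / 2.
have m1 : Num.max (sqnorm p) (sqnorm q) < 1 by rewrite gt_max p1.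
have a1 : a < 1 by rewrite /a; lra.
have [pm qm] : sqnorm p <= Num.max (sqnorm p) (sqnorm q) /\
   sqnorm q <= Num.max (sqnorm p) (sqnorm q) by rewrite !le_max !lexx orbT.
have [pa qa] : sqnorm p < a /\ sqnorm q < a by rewrite /a; split; lra.
pose b := (a + 1) / 2.
have ab : a < b by rewrite /b; lra.
have b1 : b < 1 by rewrite /b; lra.
pose u x := bump a b x *: (q - p).
have Cu : Ck k setT u.
  by apply: Ck_scale; [exact: openT|move=> m _; exact: Cs_bump|apply: Ck_cst; exact: openT].
have KU : [set x : 'rV[R]_n | sqnorm x <= b] `<=` [set x | sqnorm x < 1].
  by move=> x /= /le_lt_trans; apply.
have u0 x : ~ sqnorm x <= b -> u x = 0.
  by move=> /negP; rewrite -ltNge => /ltW h; rewrite /u bump0 ?scale0r.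
have [eta eta0 etaP] := cdiff_small k0 Cu (@compact_sqnorm_le R n b) KU u0.
have [N Neta] : exists N : nat, N.+1%:R^-1 <= eta.
  exists (Num.truncn eta^-1); rewrite invf_ple ?posrE ?ltr0n//.
  by apply/ltW; exact: truncnS_gt.
pose s : R := N.+1%:R^-1.
have s0 : 0 < s by rewrite invr_gt0 ltr0n.
have dP : cdiff k [set x | sqnorm x < 1] (fun x => x + s *: u x).
  by apply: etaP; rewrite gtr0_norm.
exists (iter N.+1 (fun x => x + s *: u x)); first exact: cdiff_iter.
have near_a (y : 'rV[R]_n) : sqnorm (p + y) < a ->
    \forall x \near p, sqnorm (x + y) < a.
  move=> pya; have : open ((fun x => sqnorm (x + y)) @^-1` [set t | t < a]).
    apply: open_comp; last exact: open_lt.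
    move=> x _; apply: (@continuous_comp _ _ _ (fun x => x + y) (@sqnorm R n));
      last exact: sqnorm_continuous.
    apply: (lipschitz_continuous (c := 1)) => // z z'.
    by rewrite opprD addrACA subrr addr0 mul1r.
  by move=> o; apply: (open_nbhs_nbhs (conj o _)).
have pa' : sqnorm (p + 0) < a by rewrite addr0.
have qa' : sqnorm (p + (q - p)) < a by rewrite addrC subrK.
near=> x.
have xa : sqnorm x < a by rewrite -[x]addr0; near: x; exact: near_a.
have xqa : sqnorm (x + (q - p)) < a by near: x; exact: near_a.
suff IH j : (j <= N.+1)%N ->
    iter j (fun x => x + s *: u x) x = x + (j%:R * s) *: (q - p).
  by rewrite IH// /s mulfV ?scale1r// pnatr_eq0.
elim: j => [|j IH] jN; first by rewrite mul0r scale0r addr0.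
rewrite iterS IH; last exact: ltnW.
rewrite /u bump1//.
  by rewrite scale1r -addrA -scalerDl -[in RHS]natr1 mulrDl mul1r.
have -> : q - p = x + (q - p) - x by rewrite addrAC subrr add0r.
have js : 0 <= j%:R * s <= 1.
  rewrite mulr_ge0 ?ler0n ?(ltW s0)//= /s ler_pdivrMr ?ltr0n// mul1r ler_nat.
  exact: ltnW.
rewrite (le_trans (sqnorm_segment _ _ js))//.
by move: js => /andP[j0 j1]; nra.
Unshelve. all: by end_near. Qed.

End Models.

(** * Cut-off functions of small support *)

Section LocalBump.
Context {R : realType} {n : nat}.
Implicit Types (q x : 'rV[R]_n) (d : R).

(** The cut-off function around [q] at scale [d]: equal to 1 near [q], and
    zero off [local_support], of radius at most 2d. *)
Definition local_bump q d x : R := bump 1 2 (d^-1 *: (x - q)).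

Definition local_support q d : set 'rV[R]_n :=
  [set x | sqnorm (d^-1 *: (x - q)) <= 2].

Lemma Ck_affine k (a : R) q : Ck k setT (fun x => a *: (x - q)).
Proof.
apply: Ck_scale; [exact: openT|by move=> m _; exact: Cs_cst|].
by apply: CkD; [exact: openT|apply: Ck_id; exact: openT|apply: Ck_cst; exact: openT].
Qed.

Lemma Ck_centered_mulmx k (B : 'M[R]_n) q : Ck k setT (fun x => (x - q) *m B).
Proof.
apply: (Ck_comp (W := setT) (f := fun x => x *m B)) => //; try exact: openT.
  by apply: Ck_mulmx; exact: openT.
by apply: Ck_ext (Ck_affine k 1 q) => [|x _]; [exact: openT|rewrite scale1r].
Qed.

Lemma Cs_local_bump q d m : Cs m setT (local_bump q d).
Proof.
apply: (Cs_comp (W := setT) (f := bump 1 2)) => //; try exact: openT.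
  exact: Cs_bump.
exact: (Ck_affine (Finite_order m)).
Qed.

Lemma local_bump0 q d x : ~ local_support q d x -> local_bump q d x = 0.
Proof.
rewrite /local_support /= => /negP; rewrite -ltNge => /ltW h.
by rewrite /local_bump bump0// ltr1n.
Qed.

Lemma local_bump_itv q d x : 0 <= local_bump q d x <= 1.
Proof. exact: bump_itv. Qed.

Lemma local_support_le q d x : 0 < d -> local_support q d x -> `|x - q| <= 2 * d.
Proof.
move=> d0 /= h; have := le_trans (norm_sqnorm _) h.
rewrite normrZ gtr0_norm ?invr_gt0// => h2.
rewrite -ler_pdivrMr// mulrC.
have : 0 <= d^-1 * `|x - q| by rewrite mulr_ge0// invr_ge0 ltW.
by move: (d^-1 * _) h2 => t; nra.
Qed.

Lemma local_support_compact q d : 0 < d -> compact (local_support q d).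
Proof.
move=> d0.
have -> : local_support q d = (fun y => q + d *: y) @` [set y | sqnorm y <= 2].
  apply/seteqP; split=> [x /= h|_ [y /= y2 <-]].
    exists (d^-1 *: (x - q)) => //.
    by rewrite scalerA mulfV ?gt_eqF// scale1r addrC subrK.
  by rewrite /local_support /= addrAC subrr add0r scalerA mulVf ?gt_eqF// scale1r.
apply: continuous_compact; last exact: compact_sqnorm_le.
apply: continuous_subspaceT.
apply: (lipschitz_continuous (c := d)) => // z z'.
by rewrite opprD addrACA subrr add0r -scalerBr normrZ gtr0_norm.
Qed.

Lemma near_local_bump q d : \forall x \near q, local_bump q d x = 1.
Proof.
have : open ((fun x => d^-1 *: (x - q)) @^-1` [set y | sqnorm y < 1]).
  apply: open_comp; last exact: open_sqnorm_lt.
  move=> x _.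
  exact: (Ck_continuous (k := Finite_order 0) openT (Ck_affine _ _ _)).
move=> o; have : nbhs q ((fun x => d^-1 *: (x - q)) @^-1` [set y | sqnorm y < 1]).
  by apply: (open_nbhs_nbhs (conj o _)); rewrite /= subrr scaler0 sqnorm0.
by apply: filterS => x /= /ltW h; rewrite /local_bump bump1// ltr1n.
Qed.

(** All these functions are rescalings of one of them, which gives a constant
    L independent of the scale. *)
Lemma local_bump_lipschitz : exists2 L : R, 0 < L &
  forall q d, 0 < d -> forall x y,
    `|local_bump q d x - local_bump q d y| <= L / d * `|x - y|.
Proof.
pose u (x : 'rV[R]_n) : 'rV[R]_1 := const_mx (bump 1 2 x).
have Cu : Cn 1 setT u.
  apply/(CnP openT) => i; apply: (Cs_ext (f := bump 1 2)); first exact: openT.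
    by move=> x _; rewrite mxE.
  exact: Cs_bump.
have u0 x : ~ [set x : 'rV[R]_n | sqnorm x <= 2] x -> u x = 0.
  move=> /= /negP; rewrite -ltNge => /ltW h; apply/rowP => i.
  by rewrite !mxE bump0// ltr1n.
have [L L0 LP] := compact_support_lipschitz Cu (@compact_sqnorm_le R n 2) u0.
exists L => // q d d0 x y; rewrite /local_bump.
have := LP (d^-1 *: (x - q)) (d^-1 *: (y - q)).
rewrite -scalerBr opprB subrKA normrZ gtr0_norm ?invr_gt0// mulrA.
apply: le_trans.
have := coord_le_norm (u (d^-1 *: (x - q)) - u (d^-1 *: (y - q))) 0.
by rewrite !mxE.
Qed.

Lemma open_contains_norm_ball (U : set 'rV[R]_n) q : open U -> U q ->
  exists2 d, 0 < d & forall x, `|x - q| <= d -> U x.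
Proof.
move=> oU Uq; have /nbhs_normP[d /= d0 dU] := open_nbhs_nbhs (conj oU Uq).
exists (d / 2) => [|x xq]; first by rewrite divr_gt0.
apply: dU => /=; rewrite distrC (le_lt_trans xq)//.
by rewrite ltr_pdivrMr// ltr_pMr// ltr1n.
Qed.

End LocalBump.

(** * Linear germs *)
Section LinearGerms.
Context {R : realType} {n : nat}.
Variables (k : smoothness) (U : set 'rV[R]_n) (q : 'rV[R]_n).
Hypotheses (k0 : positive_order k) (oU : open U) (Uq : U q).

Definition realizes_germ (f : 'rV[R]_n -> 'rV[R]_n) : Prop :=
  exists2 P, cdiff k U P & \forall x \near q, P x = f x.

Lemma cdiff_continuous (V : set 'rV[R]_n) (P : 'rV[R]_n -> 'rV[R]_n) :
  cdiff k V P -> continuous P.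
Proof. by move=> [Q [CP _ _ _ _]] x; exact: (Ck_continuous openT CP). Qed.

Lemma realizes_comp (f g : 'rV[R]_n -> 'rV[R]_n) : g q = q ->
  realizes_germ f -> realizes_germ g -> realizes_germ (f \o g).
Proof.
move=> gq [P dP Pf] [Q dQ Qg]; exists (P \o Q); first exact: cdiff_comp.
have Qq : Q q = q by rewrite (nbhs_singleton Qg).
have Qc : Q @ q --> q by rewrite -{2}Qq; exact: cdiff_continuous dQ q.
near=> x; rewrite /= -(_ : Q x = g x); last by near: x.
by near: x; exact: (Qc _ Pf).
Unshelve. all: by end_near. Qed.

(** Row vectors are used, so the matrix acts on the right. *)
Definition linear_germ (A : 'M[R]_n) (x : 'rV[R]_n) : 'rV[R]_n := q + (x - q) *m A.

Lemma linear_germ_small (E : 'M[R]_n) : exists2 eta : R, 0 < eta &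
  forall s, `|s| <= eta -> realizes_germ (linear_germ (1%:M + s *: E)).
Proof.
have [d d0 dU] := open_contains_norm_ball oU Uq.
have d20 : 0 < d / 2 by rewrite divr_gt0.
pose u x := local_bump q (d / 2) x *: ((x - q) *m E).
have Cu : Ck k setT u.
  apply: Ck_scale; [exact: openT|by move=> m _; exact: Cs_local_bump|].
  exact: Ck_centered_mulmx.
have KU : local_support q (d / 2) `<=` U.
  move=> x /(local_support_le d20); rewrite mulrC divfK ?pnatr_eq0//.
  exact: dU.
have u0 x : ~ local_support q (d / 2) x -> u x = 0.
  by move=> /local_bump0; rewrite /u => ->; rewrite scale0r.
have [eta eta0 etaP] := cdiff_small k0 Cu (local_support_compact d20) KU u0.
exists eta => // s /etaP dP; exists (fun x => x + s *: u x) => //.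
near=> x; rewrite /u (_ : local_bump _ _ x = 1); last first.
  by near: x; exact: near_local_bump.
rewrite scale1r /linear_germ mulmxDr mulmx1 addrA [q + _]addrC subrK.
by rewrite -scalemxAr.
Unshelve. all: by end_near. Qed.

Lemma linear_germ1 : realizes_germ (linear_germ 1%:M).
Proof.
exists id; first exact: cdiff_id.
by near=> x; rewrite /linear_germ mulmx1 addrC subrK.
Unshelve. all: by end_near. Qed.

Lemma linear_germM A B : realizes_germ (linear_germ A) ->
  realizes_germ (linear_germ B) -> realizes_germ (linear_germ (A *m B)).
Proof.
move=> rA rB.
have -> : linear_germ (A *m B) = linear_germ B \o linear_germ A.
  by apply/funext => x; rewrite /linear_germ /= addrAC subrr add0r mulmxA.
by apply: realizes_comp => //; rewrite /linear_germ subrr mul0mx addr0.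
Qed.

(** One transvection with a large coefficient is a power of one with a small
    coefficient, and a scaling by d is a power of a scaling by d^(1/N), which
    tends to 1. Small ones are realized by [linear_germ_small]. *)
Lemma linear_germ_elementary :
  elementary_closed (fun A => realizes_germ (linear_germ A)).
Proof.
split; [exact: linear_germ1|exact: linear_germM| |].
- move=> i j c ij; pose E : 'M[R]_n := delta_mx i j.
  have EE : E *m E = 0 by rewrite mul_delta_mx_0// eq_sym.
  have [eta eta0 etaP] := linear_germ_small E.
  have [N Nc] : exists N : nat, `|c| / N.+1%:R <= eta.
    exists (Num.truncn (`|c| / eta)); rewrite ler_pdivrMr ?ltr0n// mulrC.
    by rewrite -ler_pdivrMr// ltW// truncnS_gt.
  pose s := c / N.+1%:R.
  have rs : realizes_germ (linear_germ (1%:M + s *: E)).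
    by apply: etaP; rewrite normrM normfV [X in _ / X]ger0_norm.
  have r m : realizes_germ (linear_germ (1%:M + (m%:R * s) *: E)).
    elim: m => [|m IH]; first by rewrite mul0r scale0r addr0; exact: linear_germ1.
    have := linear_germM IH rs.
    rewrite mulmxDl mul1mx mulmxDr mulmx1 -scalemxAl -scalemxAr EE !scaler0 addr0.
    by rewrite -addrA -scalerDl -[in X in _ -> X]natr1 mulrDl mul1r [s + _]addrC.
  by have := r N.+1; rewrite /s mulrC divfK ?pnatr_eq0.
- move=> i d d0; pose E : 'M[R]_n := delta_mx i i.
  have EE : E *m E = E by rewrite mul_delta_mx.
  have [eta eta0 etaP] := linear_germ_small E.
  have [r r0 rP] : exists2 r, 0 < r & forall t : R, `|t| <= r -> `|expR t - 1| <= eta.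
    have : {for (0 : R), continuous (@expR R)} by exact: continuous_expR.
    move=> /cvgrPdist_le/(_ _ eta0)/nbhs_normP[r /= r0 rP].
    exists (r / 2) => [|t tr]; first by rewrite divr_gt0.
    rewrite distrC -(expR0 R); apply: rP => /=; rewrite sub0r normrN.
    by rewrite (le_lt_trans tr)// ltr_pdivrMr// ltr_pMr// ltr1n.
  have [N Nc] : exists N : nat, `|ln d| / N.+1%:R <= r.
    exists (Num.truncn (`|ln d| / r)); rewrite ler_pdivrMr ?ltr0n// mulrC.
    by rewrite -ler_pdivrMr// ltW// truncnS_gt.
  pose s := expR (ln d / N.+1%:R).
  have rs : realizes_germ (linear_germ (1%:M + (s - 1) *: E)).
    by apply: etaP; apply: rP; rewrite normrM normfV [X in _ / X]ger0_norm.
  have rm m : realizes_germ (linear_germ (1%:M + (s ^+ m - 1) *: E)).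
    elim: m => [|m IH]; first by rewrite subrr scale0r addr0; exact: linear_germ1.
    have := linear_germM IH rs.
    have -> // : (1%:M + (s ^+ m - 1) *: E) *m (1%:M + (s - 1) *: E) =
        1%:M + (s ^+ m.+1 - 1) *: E.
    rewrite mulmxDl mul1mx mulmxDr mulmx1 -scalemxAl -scalemxAr EE scalerA.
    rewrite -addrA -!scalerDl; congr (_ + _ *: _).
    by rewrite exprSr; ring.
  have := rm N.+1; rewrite /s -expRM_natl mulrC divfK ?pnatr_eq0//.
  by rewrite lnK.
Qed.

Lemma linear_germ_realized A : 0 < \det A -> realizes_germ (linear_germ A).
Proof. exact: (elementary_generate linear_germ_elementary). Qed.

End LinearGerms.

(** * Arbitrary germs *)
Section Germs.
Context {R : realType} {n : nat}.
Variables (k : smoothness) (U W : set 'rV[R]_n) (q : 'rV[R]_n).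
Hypotheses (k0 : positive_order k).
Hypotheses (oU : open U) (Uq : U q) (oW : open W) (Wq : W q).

Lemma small_lipschitz_near (r : 'rV[R]_n -> 'rV[R]_n) (eta : R) :
  Cn 1 W r -> (forall v, 'D_v r q = 0) -> 0 < eta ->
  exists2 d, 0 < d & forall x y, `|x - q| <= d -> `|y - q| <= d ->
    `|r x - r y| <= eta * `|x - y|.
Proof.
move=> [rd rD] r0 eta0; pose e := eta / n.+1%:R.
have e0 : 0 < e by rewrite divr_gt0.
have rnear j : \forall x \near q, `|'D_(delta_mx 0 j) r x| <= e.
  have /cvgrPdist_le/(_ _ e0) := rD (delta_mx 0 j) q Wq.
  by rewrite r0; apply: filterS => x; rewrite sub0r normrN.
have /nbhs_normP[d /= d0 dP] : \forall x \near q, W x /\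
    forall j : 'I_n, `|'D_(delta_mx 0 j) r x| <= e.
  apply: filterI; first exact: (open_nbhs_nbhs (conj oW Wq)).
  exact: (filter_forall (nbhs_filter q) rnear).
exists (d / 2) => [|x y xq yq]; first by rewrite divr_gt0.
apply: norm_row_le => [|i]; first by rewrite mulr_ge0// ltW.
have -> : (r x - r y) 0 i = r x 0 i - r y 0 i by rewrite !mxE.
have seg (t : R) : 0 <= t <= 1 -> W (y + t *: (x - y)) /\
    forall j : 'I_n, `|'D_(delta_mx 0 j) r (y + t *: (x - y))| <= e.
  move=> /andP[t0 t1]; apply: dP => /=.
  have -> : q - (y + t *: (x - y)) = - ((1 - t) *: (y - q) + t *: (x - q)).
    apply/rowP => j; rewrite !mxE; ring.
  rewrite normrN (le_lt_trans (ler_normD _ _))// !normrZ.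
  rewrite (ger0_norm t0) ger0_norm ?subr_ge0//.
  by move: xq yq; move: `|x - q| `|y - q| => a b; nra.
apply: (@le_trans _ _ (n%:R * e * `|x - y|)); last first.
  rewrite ler_wpM2r// /e mulrA ler_pdivrMr ?ltr0n// mulrC ler_wpM2l ?(ltW eta0)//.
  by rewrite ler_nat.
apply: (mean_value_le (f := fun x => r x 0 i)) => t /seg[Wt Dt]; split.
  by have /differentiable_rowP := rd _ Wt.
move=> j; rewrite -derive_rowE; last exact: rd.
by rewrite (le_trans (coord_le_norm _ _)).
Qed.

(** Put r = d - id and let chi be the cut-off function at scale delta. In
    chi(x) r(x) - chi(y) r(y) = (chi(x) - chi(y)) r(x) + chi(y) (r(x) - r(y))
    the first factor is at most (L/delta) |x - y|, while |r(x)| <= 2 delta eta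
    since r(q) = 0: the scale cancels, and chi r has Lipschitz constant
    (1 + 2L) eta, equal to 1/2 for the chosen eta. *)
Lemma identity_germ_realized (d : 'rV[R]_n -> 'rV[R]_n) :
  Ck k W d -> d q = q -> (forall v, 'D_v d q = v) -> realizes_germ k U q d.
Proof.
move=> Cd dq Dd; pose r x := d x + (-1) *: x.
have Cr : Ck k W r.
  apply: CkD => //; apply: Ck_scale => //; first by move=> m _; exact: Cs_cst.
  exact: Ck_id.
have rq : r q = 0 by rewrite /r dq scaleN1r subrr.
have Dr v : 'D_v r q = 0.
  have dd : derivable d q v.
    by apply: diff_derivable; exact: (Ck_differentiable oW k0 Cd).
  have di : derivable (@id 'rV[R]_n) q v by exact: derivable_id.
  have dZ := derivableZ (k := -1) di.
  apply: (etrans (deriveD dd dZ)).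
  apply: (etrans (congr2 +%R (Dd v) (deriveZ (-1) di))).
  by rewrite derive_id scaleN1r subrr.
have [L L0 LP] := @local_bump_lipschitz R n.
pose eta := (2 * (1 + 2 * L))^-1.
have eta0 : 0 < eta by rewrite invr_gt0 mulr_gt0// addr_gt0// mulr_gt0.
have [d1 d10 rP] := small_lipschitz_near (Ck_Cn1 oW k0 Cr) Dr eta0.
have [d2 d20 UP] := open_contains_norm_ball (openI oU oW) (conj Uq Wq).
pose del := Num.min d1 d2 / 2.
have del0 : 0 < del by rewrite divr_gt0// lt_min d10.
have KP x : local_support q del x -> `|x - q| <= d1 /\ `|x - q| <= d2.
  move=> /(local_support_le del0); rewrite /del mulrC divfK ?pnatr_eq0//.
  by rewrite le_min => /andP[].
pose K := local_support q del.
have cK : compact K by exact: local_support_compact.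
pose u x := local_bump q del x *: r x.
have u0 x : ~ K x -> u x = 0.
  by move=> /local_bump0; rewrite /u => ->; rewrite scale0r.
have Cu : Ck k setT u.
  have oK : open (~` K).
    by apply: closed_openC; apply: compact_closed => //; exact: norm_hausdorff.
  have -> : setT = W `|` ~` K.
    rewrite eqEsubset; split => // x _.
    have [/KP[_ /UP[_ Wx]]|] := pselect (K x); first by left.
    by right.
  apply: CkU => //.
    apply: Ck_scale => // m _; exact: Cs_sub (@subsetT _ _) (Cs_local_bump _ _ _).
  by apply: (Ck_ext (f := fun=> 0)) => // [x /u0|]; [|exact: Ck_cst].
have ulip1 x y : K x -> `|u x - u y| <= 2^-1 * `|x - y|.
  move=> Kx; have [xd1 xd2] := KP _ Kx.
  have rx : `|r x| <= eta * (2 * del).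
    have := rP x q xd1; rewrite subrr normr0 (ltW d10) rq subr0 => /(_ isT) h.
    rewrite (le_trans h)// ler_wpM2l ?(ltW eta0)//.
    exact: local_support_le.
  have bb : `|local_bump q del x - local_bump q del y| * `|r x| <=
      2 * L * eta * `|x - y|.
    rewrite (le_trans (ler_pM _ _ (LP q del del0 x y) rx))//.
    rewrite le_eqVlt; apply/orP; left; apply/eqP; field.
    by rewrite gt_eqF.
  have -> : u x - u y = (local_bump q del x - local_bump q del y) *: r x +
      local_bump q del y *: (r x - r y).
    rewrite /u; move: (local_bump q del x) (local_bump q del y) => a b.
    by rewrite scalerBl scalerBr addrA subrK.
  have br : `|local_bump q del y *: (r x - r y)| <= eta * `|x - y|.
    have [Ky|/local_bump0 ->] := pselect (K y); last first.
      by rewrite scale0r normr0 mulr_ge0// ltW.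
    have [yd1 _] := KP _ Ky.
    have /andP[b0 b1] := local_bump_itv q del y.
    rewrite normrZ ger0_norm// (le_trans _ (rP x y xd1 yd1))//.
    by rewrite ler_piMl.
  rewrite (le_trans (ler_normD _ _))// normrZ (le_trans (lerD bb br))//.
  rewrite -mulrDl ler_wpM2r// -[X in _ + X]mul1r -mulrDl /eta invfM mulrCA.
  rewrite [2 * L + 1]addrC mulfV ?mulr1//.
  by rewrite gt_eqF// addr_gt0// mulr_gt0.
exists (fun x => x + u x).
  apply: (cdiff_perturbation (K := K)) => //; last first.
    by move=> x /KP[_ /UP[]].
  move=> x y; have [Kx|nKx] := pselect (K x); first exact: ulip1.
  have [Ky|nKy] := pselect (K y); first by rewrite distrC [`|x - y|]distrC ulip1.
  by rewrite !u0// subrr normr0 mulr_ge0// invr_ge0.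
near=> x; rewrite /u (_ : local_bump _ _ x = 1); last first.
  by near: x; exact: near_local_bump.
by rewrite scale1r /r scaleN1r addrC subrK.
Unshelve. all: by end_near. Qed.

Lemma Ck_linear_germ (B : 'M[R]_n) : Ck k setT (linear_germ q B).
Proof.
apply: CkD; [exact: openT|by apply: Ck_cst; exact: openT|].
exact: Ck_centered_mulmx.
Qed.

Lemma is_diff_linear_germ (B : 'M[R]_n) x :
  is_diff x (linear_germ q B) (mulmxr B).
Proof.
apply: is_diff_of_estimate; first exact: mulmx_continuous.
move=> e e0; apply/nbhs_normP; exists 1 => //= h _.
rewrite [X in `|X|](_ : _ = 0) ?normr0 ?mulr_ge0 ?(ltW e0)//.
rewrite /linear_germ /= opprD addrACA subrr add0r -mulmxBl opprB subrKA.
by rewrite addrK subrr.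
Qed.

(** Composing [c] with the inverse of its linear part leaves a germ tangent to
    the identity. *)
Lemma germ_realized (c : 'rV[R]_n -> 'rV[R]_n) :
  Ck k W c -> c q = q -> 0 < \det (jacobian c q) -> realizes_germ k U q c.
Proof.
move=> Cc cq dc; set A := jacobian c q in dc.
have Au : A \in unitmx by rewrite unitmxE unitfE gt_eqF.
pose d := linear_germ q (invmx A) \o c.
have dq : d q = q by rewrite /d /= cq /linear_germ subrr mul0mx addr0.
have dcq : differentiable c q by exact: (Ck_differentiable oW k0 Cc).
have rd : realizes_germ k U q d.
  apply: identity_germ_realized => //.
    exact: (Ck_comp (W := setT) oW openT _ (Ck_linear_germ (invmx A)) Cc).
  move=> v; have [dl dlE] := is_diff_linear_germ (invmx A) (c q).
  apply: (etrans (deriveE v (differentiable_comp dcq dl))).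
  have E : 'd d q v = 'd (linear_germ q (invmx A)) (c q) ('d c q v).
    exact: (congr1 (fun h : 'rV[R]_n -> 'rV[R]_n => h v) (diff_comp dcq dl)).
  apply: (etrans E).
  apply: (etrans (congr1 (fun h : 'rV[R]_n -> 'rV[R]_n => h ('d c q v)) dlE)).
  rewrite /= -(mul_rV_lin1 ('d c q)); exact: mulmxK.
have [|P dP Pc] := realizes_comp _ (linear_germ_realized k0 oU Uq dc) rd.
  by [].
exists P => //; near=> x.
have -> : c x = (linear_germ q A \o d) x.
  by rewrite /d /linear_germ /= [q + _ - q]addrAC subrr add0r mulmxKV// addrC subrK.
by near: x.
Unshelve. all: by end_near. Qed.

End Germs.

(** * Diffeomorphisms onto open images *)
Section Embeddings.
Context {R : realType} {n : nat}.
Implicit Types (k : smoothness) (U V W O : set 'rV[R]_n).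
Implicit Types (f g phi : 'rV[R]_n -> 'rV[R]_n).

Definition embedding k W phi := Ck_diffeo k W (phi @` W) phi.

Lemma open_setI_preimage V O f : open V -> (forall x, V x -> {for x, continuous f}) ->
  open O -> open (V `&` f @^-1` O).
Proof.
move=> oV fc oO; rewrite openE => x [Vx Ox]; apply: filterI.
  exact: (open_nbhs_nbhs (conj oV Vx)).
exact: fc x Vx O (open_nbhs_nbhs (conj oO Ox)).
Qed.

Lemma embedding_inverse k W phi : embedding k W phi -> exists psi,
  [/\ embedding k (phi @` W) psi, psi @` (phi @` W) = W,
      (forall x, W x -> psi (phi x) = x) &
      (forall y, (phi @` W) y -> phi (psi y) = y)].
Proof.
move=> Dphi; have [oW oV _ Cphi _] := Dphi.
have [psi [Cpsi phiK psiK]] := Ck_diffeo_inverse Dphi.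
have imW : psi @` (phi @` W) = W.
  apply/seteqP; split=> [_ [y /psiK[Wy _] <-]//|x Wx].
  by exists (phi x); [exists x|have [] := phiK _ Wx].
exists psi; split=> //.
- by split=> //; [rewrite imW|exists phi; split=> [|y /psiK[]//]; rewrite imW].
- by move=> x /phiK[].
- by move=> y /psiK[].
Qed.

Lemma embedding_restrict k W O phi : open O -> O `<=` W ->
  embedding k W phi -> embedding k O phi.
Proof.
move=> oO OW Dphi; have [oW oV _ Cphi _] := Dphi.
have [psi [[_ _ _ Cpsi _] imW phiK psiK]] := embedding_inverse Dphi.
have OE : phi @` O = (phi @` W) `&` psi @^-1` O.
  apply/seteqP; split=> [_ [x Ox <-]|_ [[x Wx <-]]] /=.
    by split; [exists x => //; exact: OW|rewrite phiK//; exact: OW].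
  by rewrite phiK// => Ox; exists x.
have oO' : open (phi @` O).
  rewrite OE; apply: open_setI_preimage => // y Vy.
  exact: (Ck_continuous oV Cpsi).
split=> //; first exact: Ck_sub OW Cphi.
exists psi; split=> [|x /OW]; last exact: phiK.
by apply: Ck_sub Cpsi => //; exact: image_subset.
Qed.

Lemma embedding_open k W O phi : embedding k W phi -> open O -> O `<=` W ->
  open (phi @` O).
Proof. by move=> Dphi oO OW; have [] := embedding_restrict oO OW Dphi. Qed.

Lemma embedding_comp k W W' f g : embedding k W f -> embedding k W' g ->
  f @` W `<=` W' -> embedding k W (g \o f).
Proof.
move=> Df Dg fW; have [oW oV _ Cf _] := Df.
have Dg' := embedding_restrict oV fW Dg.
have [_ oV' _ Cg _] := Dg'.
have [f' [[_ _ _ Cf' _] _ fK f'K]] := embedding_inverse Df.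
have [g' [[_ _ _ Cg' _] imf gK g'K]] := embedding_inverse Dg'.
have Wf x : W x -> (f @` W) (f x) by move=> Wx; exists x.
split=> //.
- by rewrite -image_comp.
- exact: Ck_comp oW oV Wf Cg Cf.
exists (f' \o g'); split; last by move=> x Wx; rewrite /= gK ?fK//; exact: Wf.
rewrite -image_comp; apply: Ck_comp oV' oV _ Cf' Cg'.
by move=> y Vy; rewrite -imf; exists y.
Qed.

Lemma cdiff_embedding k U P : cdiff k U P -> forall O, open O -> embedding k O P.
Proof.
move=> [Q [CP CQ PK QK _]] O oO.
apply: (embedding_restrict (W := setT)) => //.
have imT : P @` setT = setT.
  by apply/seteqP; split => // y _; exists (Q y).
by rewrite /embedding imT; split=> //; try exact: openT; exists Q.
Qed.

Lemma mul_jacobian (v : 'rV[R]_n) f x : v *m jacobian f x = 'd f x v.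
Proof. exact: mul_rV_lin1. Qed.

Lemma jacobian_comp f g x : differentiable f x -> differentiable g (f x) ->
  jacobian (g \o f) x = jacobian f x *m jacobian g (f x).
Proof.
move=> df dg; apply/row_matrixP => i; pose v : 'rV[R]_n := delta_mx 0 i.
have fgv : v *m jacobian (g \o f) x = 'd g (f x) ('d f x v).
  rewrite mul_jacobian.
  exact: (congr1 (fun h : 'rV[R]_n -> 'rV[R]_n => h v) (diff_comp df dg)).
have gv : 'd f x v *m jacobian g (f x) = 'd g (f x) ('d f x v).
  exact: mul_jacobian.
have fv : v *m jacobian f x *m jacobian g (f x) = 'd f x v *m jacobian g (f x).
  by congr (_ *m _); exact: mul_jacobian.
rewrite !rowE; apply: (etrans fgv); apply: (etrans (esym gv)).
by apply: (etrans (esym fv)); rewrite mulmxA.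
Qed.

Lemma near_eq_jacobian f g x : (\forall y \near x, f y = g y) ->
  differentiable f x -> jacobian f x = jacobian g x.
Proof.
move=> fg df; apply/row_matrixP => i.
have dg := near_eq_differentiable fg df.
apply: (etrans (rowE i _)); apply: (etrans (mul_jacobian _ f x)).
apply: (etrans (esym (deriveE _ df))); apply: (etrans (near_eq_derive _ fg)).
apply: (etrans (deriveE _ dg)); apply: (etrans (esym (mul_jacobian _ g x))).
exact: (esym (rowE i _)).
Qed.

Lemma jacobian_translation (v : 'rV[R]_n) x : jacobian (fun y => y + v) x = 1%:M.
Proof.
apply/row_matrixP => i; rewrite !rowE mul_jacobian mulmx1.
have dD : is_diff x (id + cst v) (id + 0) by exact: is_diffD.
have -> : (fun y => y + v) = id + cst v by [].
by rewrite diff_val !fctE /= addr0.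
Qed.

Lemma embedding_differentiable k W phi x : positive_order k ->
  embedding k W phi -> W x -> differentiable phi x.
Proof. by move=> k0 [oW _ _ Cphi _]; exact: (Ck_differentiable oW k0 Cphi). Qed.

Lemma jacobian_inverse k W phi psi x : positive_order k -> embedding k W phi ->
  embedding k (phi @` W) psi -> (forall x, W x -> psi (phi x) = x) -> W x ->
  jacobian phi x *m jacobian psi (phi x) = 1%:M.
Proof.
move=> k0 Dphi Dpsi phiK Wx; have [oW _ _ _ _] := Dphi.
have dphi := embedding_differentiable k0 Dphi Wx.
have dpsi : differentiable psi (phi x).
  by apply: (embedding_differentiable k0 Dpsi); exists x.
rewrite -jacobian_comp// -(jacobian_translation 0 x).
apply: near_eq_jacobian; last exact: differentiable_comp.
by apply: filterS (open_nbhs_nbhs (conj oW Wx)) => y /phiK /= ->; rewrite addr0.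
Qed.

Lemma embedding_det_neq0 k W phi x : positive_order k -> embedding k W phi ->
  W x -> \det (jacobian phi x) != 0.
Proof.
move=> k0 Dphi Wx; have [psi [Dpsi _ phiK _]] := embedding_inverse Dphi.
have [Ju _] := mulmx1_unit (jacobian_inverse k0 Dphi Dpsi phiK Wx).
by move: Ju; rewrite unitmxE unitfE.
Qed.

Lemma det_jacobian_continuous k W phi : positive_order k -> embedding k W phi ->
  forall x, W x -> {for x, continuous (fun y => \det (jacobian phi y))}.
Proof.
move=> k0 [oW _ _ Cphi _]; have [dphi Dphi] := Ck_Cn1 oW k0 Cphi.
apply: (Cs_continuous (m := 0)).
apply: Cs_det => // i j.
have C0 : Cn 0 W (fun x => 'D_(delta_mx 0 i) phi x) := Dphi _.
have := (CnP oW).1 C0 j; apply: Cs_ext => // x Wx.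
by rewrite /jacobian mxE (deriveE _ (dphi x Wx)).
Qed.

(** Intermediate value theorem on the segment from x to y. *)
Lemma ball_constant_sign (r : R) (D : 'rV[R]_n -> R) x y : 0 < r ->
  (forall z, eball 0 r z -> D z != 0) ->
  (forall z, eball 0 r z -> {for z, continuous D}) ->
  eball 0 r x -> eball 0 r y -> 0 < D x * D y.
Proof.
move=> r0 DN0 Dc Bx By; pose l (t : R) := x + t *: (y - x).
have Bl t : 0 <= t <= 1 -> eball 0 r (l t).
  move=> t01; have := sqnorm_segment x y t01; move: Bx By t01.
  rewrite eball0E//= => Bx By /andP[t0 t1] h.
  have m_lt : Num.max (sqnorm x) (sqnorm y) < r ^+ 2 by rewrite gt_max Bx By.
  apply: le_lt_trans m_lt; apply: (le_trans h).
  have : sqnorm x <= Num.max (sqnorm x) (sqnorm y) by rewrite le_max lexx.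
  have : sqnorm y <= Num.max (sqnorm x) (sqnorm y) by rewrite le_max lexx orbT.
  by move: (sqnorm x) (sqnorm y) (Num.max _ _) => X Y m Ym Xm; nra.
have l0 : l 0 = x by rewrite /l scale0r addr0.
have l1 : l 1 = y by rewrite /l scale1r addrC subrK.
pose f t := D (l t).
have fN0 t : 0 <= t <= 1 -> f t != 0 by move=> /Bl; exact: DN0.
have fc : {within `[0, 1], continuous f}.
  apply: continuous_in_subspaceT => t; rewrite inE/= in_itv/= => t01.
  apply: (@continuous_comp _ _ _ l D); last exact: Dc (Bl _ t01).
  apply: (lipschitz_continuous (c := `|y - x| + 1)) => [|a b].
    by rewrite ltr_wpDl.
  rewrite /l opprD addrACA subrr add0r -scalerBl normrZ mulrC ler_wpM2r//.
  by rewrite lerDl.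
rewrite -l0 -l1 -/(f 0) -/(f 1) ltNge; apply/negP => f01.
have [|c] := IVT ler01 fc (v := 0).
  rewrite ge_min le_max.
  have [h|h] := leP (f 0) 0; have [h'|h'] := leP (f 1) 0 => /=.
  - have {}h : f 0 < 0 by rewrite lt_neqAle h fN0 ?lexx ?ler01.
    have {}h' : f 1 < 0 by rewrite lt_neqAle h' fN0 ?lexx ?ler01.
    by move: f01; rewrite leNgt nmulr_rgt0// h'.
  - by rewrite (ltW h') orbT.
  - by rewrite (ltW h).
  - by move: f01; rewrite leNgt mulr_gt0.
by rewrite in_itv/= => /fN0 /eqP fc0 /fc0.
Qed.

Lemma embedding_ball_det_sign k (r : R) phi x y : positive_order k -> 0 < r ->
  embedding k (eball 0 r) phi -> eball 0 r x -> eball 0 r y ->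
  0 < \det (jacobian phi x) * \det (jacobian phi y).
Proof.
move=> k0 r0 Dphi; apply: (ball_constant_sign (D := fun z => \det (jacobian phi z))) => // z.
  by move=> Bz; exact: (embedding_det_neq0 k0 Dphi Bz).
by move=> Bz; exact: (det_jacobian_continuous k0 Dphi Bz).
Qed.

End Embeddings.

(** * The disc theorem *)

Section Transitivity.
Context {R : realType} {n : nat}.
Implicit Types (k : smoothness) (U : set 'rV[R]_n).
Implicit Types (phi P : 'rV[R]_n -> 'rV[R]_n).

Lemma det_factor_gt0 (A B C : 'M[R]_n) :
  A *m B = C -> 0 < \det A * \det C -> 0 < \det B.
Proof.
move=> <-; rewrite det_mulmx mulrA -expr2 => h.
rewrite ltNge; apply/negP => B0; move: h; rewrite ltNge.
by rewrite mulr_ge0_le0// sqr_ge0.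
Qed.

(** Transitivity by maps whose Jacobian is positive at the point moved, so
    that orientations are not reversed. *)
Definition oriented_transitive k U : Prop := forall p q, U p -> U q ->
  exists P, [/\ cdiff k U P, P p = q & 0 < \det (jacobian P p)].

Lemma cdiff_differentiable k U P x : positive_order k -> cdiff k U P ->
  differentiable P x.
Proof.
by move=> k0 [Q [CP _ _ _ _]]; exact: (Ck_differentiable openT k0 CP).
Qed.

(** Translations of the unit ball, transported by [phi]. If T moves p to q and
    is a translation near p, then P o phi = phi o T yields
    D phi (p) . D P (phi p) = D phi (q), and the two determinants of D phi have
    the same sign. *)
Lemma ball_image_transitive k (r : R) phi : positive_order k -> 1 < r ->
  embedding k (eball 0 r) phi -> oriented_transitive k (phi @` eball 0 1).
Proof.
move=> k0 r1 Dphi _ _ [p p1 <-] [q q1 <-].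
have r0 : 0 < r by rewrite (lt_trans _ r1).
have B1r : eball (0 : 'rV[R]_n) 1 `<=` eball 0 r.
  by move=> x /= /lt_trans; exact.
have [T dT Tp] := cdiff_translate k0 p1 q1.
have [P dP PT] := cdiff_transport Dphi B1r dT.
have Tpq : T p = q by rewrite (nbhs_singleton Tp) addrC subrK.
exists P; split=> //; first by rewrite PT ?Tpq//; exact: B1r.
have dphi x : eball 0 r x -> differentiable phi x.
  exact: (embedding_differentiable k0 Dphi).
have pr := B1r _ p1; have qr := B1r _ q1.
have dT' := cdiff_differentiable p k0 dT.
have dP' := cdiff_differentiable (phi p) k0 dP.
have JT : jacobian T p = 1%:M.
  by apply: (etrans (near_eq_jacobian Tp dT')); exact: jacobian_translation.
have PphiT : jacobian (P \o phi) p = jacobian (phi \o T) p.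
  apply: near_eq_jacobian; last by apply: differentiable_comp => //; exact: dphi.
  have [oW _ _ _ _] := Dphi.
  by apply: filterS (open_nbhs_nbhs (conj oW pr)) => x /PT.
have Tr : eball 0 r (T p) by rewrite Tpq.
have J1 := jacobian_comp (dphi _ pr) dP'.
have J2 := jacobian_comp dT' (dphi _ Tr).
have JE : jacobian phi p *m jacobian P (phi p) = jacobian phi (T p).
  apply: (etrans (esym J1)); apply: (etrans PphiT); apply: (etrans J2).
  by apply: (etrans (congr1 (mulmx^~ _) JT)); exact: mul1mx.
exact: (det_factor_gt0 JE (embedding_ball_det_sign k0 r0 Dphi pr Tr)).
Qed.

(** First [a] and [b] are made to agree near 0, by moving a(0) to b(0) and
    realizing the germ of b o (Q o a)^-1 there. Shrinking the parameter ball by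
    the same factor c along a and along b then carries this agreement to the
    closed unit ball: with A and A' transporting the contraction,
    A'^-1 (S (Q (A (a z)))) = A'^-1 (S (Q (a (c z)))) = A'^-1 (b (c z)) = b z. *)
Theorem disc_theorem k U (e : R) (a b : 'rV[R]_n -> 'rV[R]_n) :
  positive_order k -> open U -> oriented_transitive k U -> 0 < e ->
  embedding k (eball 0 (1 + e)) a -> embedding k (eball 0 (1 + e)) b ->
  a @` eball 0 (1 + e) `<=` U -> b @` eball 0 (1 + e) `<=` U ->
  0 < \det (jacobian a 0) * \det (jacobian b 0) ->
  exists2 M, cdiff k U M & forall z, sqnorm z <= 1 -> M (a z) = b z.
Proof.
move=> k0 oU tU e0 Da Db aU bU ab0.
set B := eball 0 (1 + e) in Da Db aU bU.
have e1 : 0 < 1 + e by rewrite addr_gt0.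
have B0 : B 0 by rewrite /B eball0E//= sqnorm0 exprn_gt0.
have aB z : B z -> U (a z) by move=> Bz; apply: aU; exists z.
have bB z : B z -> U (b z) by move=> Bz; apply: bU; exists z.
have [Q [dQ Qab JQ]] := tU _ _ (aB _ B0) (bB _ B0).
pose q := Q (a 0); have qU : U q by rewrite /q Qab; exact: bB.
have [oB oaB _ _ _] := Da.
have DQa : embedding k B (Q \o a).
  exact: (embedding_comp Da (cdiff_embedding dQ oaB)).
have [psi [Dpsi psiim psiK Kpsi]] := embedding_inverse DQa.
have [oW _ _ _ _] := Dpsi.
have Dc : embedding k ((Q \o a) @` B) (b \o psi).
  by apply: (embedding_comp Dpsi Db); rewrite psiim.
have Wq : ((Q \o a) @` B) q by exists 0.
have psiq : psi q = 0 by exact: (psiK 0 B0).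
have cq : (b \o psi) q = q by rewrite /= psiq /q Qab.
have cE z : B z -> (b \o psi) (Q (a z)) = b z.
  by move=> Bz; rewrite /= (psiK z).
have Jc : 0 < \det (jacobian (b \o psi) q).
  have da := embedding_differentiable k0 Da B0.
  have dQ' := cdiff_differentiable (a 0) k0 dQ.
  have dQa := differentiable_comp da dQ'.
  have dc := embedding_differentiable k0 Dc Wq.
  have J1 := jacobian_comp da dQ'.
  have J2 := jacobian_comp dQa dc.
  have J3 : jacobian ((b \o psi) \o (Q \o a)) 0 = jacobian b 0.
    apply: near_eq_jacobian; last exact: differentiable_comp.
    by apply: filterS (open_nbhs_nbhs (conj oB B0)) => x /cE.
  have JE : jacobian a 0 *m (jacobian Q (a 0) *m jacobian (b \o psi) q) =
      jacobian b 0.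
    apply: (etrans (mulmxA _ _ _)).
    apply: (etrans (congr1 (mulmx^~ _) (esym J1))).
    by apply: (etrans (esym J2)).
  have := det_factor_gt0 JE ab0.
  by rewrite det_mulmx pmulr_rgt0.
have [_ _ _ Cc _] := Dc.
have [S dS Sc] := germ_realized k0 oU qU oW Wq Cc cq Jc.
have [d d0 dP] : exists2 d, 0 < d & forall z, `|z| < d -> B z /\ S (Q (a z)) = b z.
  have nz : \forall z \near (0 : 'rV[R]_n), B z /\ S (Q (a z)) = b z.
    have Qac : {for 0, continuous (Q \o a)}.
      apply: differentiable_continuous.
      exact: embedding_differentiable k0 DQa B0.
    have nS : \forall z \near (0 : 'rV[R]_n), S (Q (a z)) = (b \o psi) (Q (a z)).
      exact: (Qac _ Sc).
    near=> z.
    have Bz : B z by near: z; exact: open_nbhs_nbhs.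
    by split=> //; rewrite -cE//; near: z.
  have /nbhs_normP[d /= d0 dP] := nz; exists d => // z zd.
  by apply: dP; rewrite /= sub0r normrN.
have [c [c0 cd [P dP1 Pc]]] := @cdiff_shrink R n k e d k0 e0 d0.
have [A dA AP] := cdiff_transport Da (@subset_refl _ B) dP1.
have [A' dA' AP'] := cdiff_transport Db (@subset_refl _ B) dP1.
have [A'' A''K] := cdiff_sub bU dA'.
have dA'' : cdiff k U A'' by exists A'; exact: cdiff_pairC.
exists (A'' \o (S \o Q) \o A).
  apply: cdiff_comp; last exact: cdiff_sub aU dA.
  by apply: cdiff_comp => //; exact: cdiff_comp.
move=> z z1; have Bz : B z.
  rewrite /B eball0E//= (le_lt_trans z1)//.
  by rewrite exprn_egt1// ltrDl.
have z1' : `|z| <= 1.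
  rewrite -(@ler_pXn2r _ 2)// ?nnegrE// expr1n.
  exact: le_trans (norm_sqnorm z) z1.
rewrite /= AP// Pc//.
have [_ ->] : B (c *: z) /\ S (Q (a (c *: z))) = b (c *: z).
  apply: dP; rewrite normrZ gtr0_norm// (le_lt_trans _ cd)//.
  by rewrite ler_piMr// ltW.
by rewrite -Pc// -AP'//; have [_ _ K _ _] := A''K; rewrite K.
Unshelve. all: by end_near. Qed.

End Transitivity.

(** * Closed balls and the extension *)

Lemma det_mulmx3_gt0 (R : realFieldType) n (A B C J : 'M[R]_n) :
  J = A *m B *m C -> \det A != 0 -> 0 < \det B -> 0 < \det C ->
  0 < \det A * \det J.
Proof.
move=> -> A0 B0 C0; rewrite !det_mulmx !mulrA -expr2.
by do 2!apply: mulr_gt0 => //; rewrite exprn_even_gt0.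
Qed.

Section ClosedBalls.
Context {R : realType} {n : nat}.

(** Compactness: the squared norm attains a minimum, larger than 1, on the
    points of the ball of radius 2 that lie outside [O]. *)
Lemma closed_unit_ball_nbhd (O : set 'rV[R]_n) : open O ->
  closed_eball 0 1 `<=` O -> exists2 e, 0 < e & eball 0 (1 + e) `<=` O.
Proof.
rewrite closed_eball0E => oO O1.
pose K := [set x : 'rV[R]_n | sqnorm x <= 4] `&` ~` O.
have cK : compact K.
  apply: compact_closedI; [exact: compact_sqnorm_le|exact: open_closedC].
have e_of (m : R) : 1 < m -> m <= 4 -> exists2 e : R, 0 < e & (1 + e) ^+ 2 <= m.
  (* e = (m - 1) / 5 <= 1, since m <= 4, so that 2 e + e^2 <= 5 e = m - 1 *)
  move=> m1 m4; exists ((m - 1) / 5); first by rewrite divr_gt0// subr_gt0.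
  nra.
have [K0|K0] := pselect (K !=set0); last first.
  exists 1 => // x; rewrite eball0E ?addr_gt0//= => x2.
  apply: contrapT => Ox; apply: K0; exists x; split=> //=.
  rewrite (le_trans (ltW x2))//; lra.
have [|c] := EVT_min_rV (f := @sqnorm R n) K0 cK.
  by apply: continuous_subspaceT; exact: sqnorm_continuous.
move=> /set_mem [c4 Oc] cmin.
have c1 : 1 < sqnorm c by rewrite ltNge; apply/negP => /O1.
have [e e0 ec] := e_of _ c1 c4.
exists e => // x; rewrite eball0E ?addr_gt0//= => xe.
apply: contrapT => Ox.
have Kx : K x by split=> //=; rewrite (le_trans (ltW xe))// (le_trans ec).
have := cmin x (mem_set Kx); rewrite leNgt => /negP; apply.
exact: lt_le_trans xe ec.
Qed.

(** A point of norm 1 in the open set could be pushed slightly outwards. *)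
Lemma open_in_closed_unit_ball (O : set 'rV[R]_n) : open O ->
  O `<=` closed_eball 0 1 -> O `<=` eball 0 1.
Proof.
rewrite closed_eball0E eball0E// => oO O1 z Oz /=; rewrite expr1n.
have z1 : sqnorm z <= 1 := O1 _ Oz.
rewrite lt_neqAle z1 andbT; apply/negP => /eqP zE.
have [d d0 dO] := open_contains_norm_ball oO Oz.
have nz : 0 < 1 + `|z| by rewrite ltr_pwDl.
pose s := d / (1 + `|z|).
have s0 : 0 < s by rewrite divr_gt0.
have : sqnorm ((1 + s) *: z) <= 1.
  apply: O1; apply: dO.
  rewrite scalerDl scale1r addrAC subrr add0r normrZ gtr0_norm//.
  by rewrite /s mulrAC ler_pdivrMr// ler_wpM2l ?(ltW d0)// lerDr.
have -> : sqnorm ((1 + s) *: z) = (1 + s) ^+ 2 * sqnorm z.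
  by rewrite /sqnorm mulr_sumr; apply: eq_bigr => i _; rewrite mxE exprMn.
by rewrite zE mulr1 leNgt exprn_egt1// ltrDl.
Qed.

(** Invariance of domain is avoided: [phi] is a homeomorphism between open
    sets, so the preimage of the interior is an open subset of the closed ball. *)
Lemma interior_closed_ball_image k (r : R) (phi : 'rV[R]_n -> 'rV[R]_n) :
  1 < r -> embedding k (eball 0 r) phi ->
  interior (phi @` closed_eball 0 1) = phi @` eball 0 1.
Proof.
move=> r1 Dphi; have r0 : 0 < r by rewrite (lt_trans _ r1).
have B1 : eball (0 : 'rV[R]_n) 1 `<=` closed_eball 0 1 by move=> x /= /ltW.
have Br : closed_eball (0 : 'rV[R]_n) 1 `<=` eball 0 r.
  by move=> x /= /le_lt_trans; apply.
have [psi [Dpsi imV phiK psiK]] := embedding_inverse Dphi.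
have [oB oV _ Cphi _] := Dphi.
apply/seteqP; split.
  pose O := eball 0 r `&` phi @^-1` (interior (phi @` closed_eball 0 1)).
  have oO : open O.
    apply: open_setI_preimage => //; last exact: open_interior.
    exact: Ck_continuous oB Cphi.
  have O1 : O `<=` closed_eball 0 1.
    move=> z [Bz /interior_subset [w w1 wz]].
    by rewrite -(phiK z Bz) -wz phiK//; exact: Br.
  move=> y Dy; have [w w1 wy] := interior_subset Dy.
  exists w => //; apply: open_in_closed_unit_ball oO O1 _ _.
  by split; [exact: Br|rewrite /= wy].
rewrite -open_subsetE; first exact: image_subset B1.
by apply: (embedding_open Dphi (open_eball0 ltr01)) => x /B1 /Br.
Qed.

End ClosedBalls.

Theorem corollary1p6 (R : realType) (n : nat) (hn : (2 <= n)%N)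
    (k : smoothness) (hk : positive_order k)
    (Omega D1 D2 : set 'rV[R]_n)
    (hOmega : open Omega)
    (hD1 : Ck_closed_ball k D1) (hD2 : Ck_closed_ball k D2)
    (hD21 : D2 `<=` interior D1) (hD1Omega : D1 `<=` Omega)
    (F G : 'rV[R]_n -> 'rV[R]_n)
    (hF : Ck_diffeo k Omega (F @` Omega) F)
    (hForient : orientation_preserving Omega F)
    (hG : orientation_preserving_closed_Ck_diffeo k D2 G)
    (hGF : G @` D2 `<=` F @` (interior D1)) :
  exists H : 'rV[R]_n -> 'rV[R]_n,
    [/\ Ck_diffeo k Omega (F @` Omega) H,
        (forall x, (Omega `\` interior D1) x -> H x = F x) &
        (forall x, D2 x -> H x = G x)].
Proof.
have [_ [e1 [phi1 [e10 Dphi1 im1]]]] := hD1.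
have [_ [e2 [phi2 [e20 Dphi2 im2]]]] := hD2.
have [_ [Ug [g [[D2Ug Dg gG] gorient]]]] := hG.
set U := interior D1 in hD21 hGF *.
have oU : open U by exact: open_interior.
have UD1 : U `<=` D1 by exact: interior_subset.
have UOmega : U `<=` Omega by move=> x /UD1 /hD1Omega.
have tU : oriented_transitive k U.
  have r1 : 1 < 1 + e1 by rewrite ltrDl.
  rewrite /U -im1 (interior_closed_ball_image r1 Dphi1).
  exact: ball_image_transitive hk r1 Dphi1.
have [Finv [DFinv _ FK FinvK]] := embedding_inverse hF.
have [oV _ _ CFinv _] := DFinv.
have oFU : open (F @` U) := embedding_open hF oU UOmega.
have [oUg _ _ Cg _] := Dg.
have [oB2 _ _ Cphi2 _] := Dphi2.
have D2phi2 z : closed_eball 0 1 z -> D2 (phi2 z) by move=> z1; rewrite -im2; exists z.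
(* O consists of the parameters z at which F^-1 (g (phi2 z)) is defined and
   both embeddings take values in U; it contains the closed unit ball. *)
pose O1 := Ug `&` g @^-1` (F @` U).
have oO1 : open O1.
  by apply: open_setI_preimage => //; exact: Ck_continuous oUg Cg.
pose O := eball 0 (1 + e2) `&` phi2 @^-1` (U `&` O1).
have oO : open O.
  apply: open_setI_preimage => //; last exact: openI.
  exact: Ck_continuous oB2 Cphi2.
have O_closed : closed_eball 0 1 `<=` O.
  move=> z z1; have Dz := D2phi2 z z1; split.
    by move: z1 => /= /le_lt_trans; apply; rewrite ltrDl.
  split; first exact: hD21.
  by split; [exact: D2Ug|rewrite /= gG//; apply: hGF; exists (phi2 z)].
have [e e0 eO] := closed_unit_ball_nbhd oO O_closed.
have oB : open (eball (0 : 'rV[R]_n) (1 + e)).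
  by apply: open_eball0; rewrite addr_gt0.
have B0 : eball (0 : 'rV[R]_n) (1 + e) 0.
  by rewrite eball0E ?addr_gt0//= sqnorm0 exprn_gt0// addr_gt0.
have Da : embedding k (eball 0 (1 + e)) phi2.
  by apply: (embedding_restrict oB _ Dphi2) => z /eO[].
have Dga : embedding k (eball 0 (1 + e)) (g \o phi2).
  by apply: (embedding_comp Da Dg) => _ [z /eO[_ [_ []]] ? _ <-].
have gaV : (g \o phi2) @` eball 0 (1 + e) `<=` F @` Omega.
  by move=> _ [z /eO[_ [_ [_ [x /UOmega Ox Fx]]]] <-]; exists x.
have Db : embedding k (eball 0 (1 + e)) (Finv \o (g \o phi2)).
  exact: (embedding_comp Dga DFinv).
have aU : phi2 @` eball 0 (1 + e) `<=` U by move=> _ [z /eO[_ []] ? _ <-].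
have bU : (Finv \o (g \o phi2)) @` eball 0 (1 + e) `<=` U.
  move=> _ [z /eO[_ [_ [_ [x Ux Fx]]]] <-] /=.
  by rewrite -Fx FK//; exact: UOmega.
have ab0 : 0 < \det (jacobian phi2 0) *
    \det (jacobian (Finv \o (g \o phi2)) 0).
  have [x Ux Fx] : (F @` U) ((g \o phi2) 0) by have [_ [_ []]] := eO 0 B0.
  have Ox := UOmega _ Ux.
  have D0 : D2 (phi2 0) by apply: D2phi2; rewrite closed_eball0E /= sqnorm0.
  have da := embedding_differentiable hk Da B0.
  have dg := embedding_differentiable hk Dg (D2Ug _ D0).
  have dF' : differentiable Finv ((g \o phi2) 0).
    by apply: (embedding_differentiable hk DFinv); rewrite -Fx; exists x.
  have JF : 0 < \det (jacobian Finv ((g \o phi2) 0)).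
    rewrite -Fx; apply: (det_factor_gt0 (jacobian_inverse hk hF DFinv FK Ox)).
    by rewrite det1 mulr1; exact: hForient.
  apply: (det_mulmx3_gt0 _ (embedding_det_neq0 hk Da B0) (gorient _ D0) JF).
  apply: (etrans (jacobian_comp (differentiable_comp da dg) dF')).
  exact: (congr1 (mulmx^~ _) (jacobian_comp da dg)).
have [M dM Mab] := disc_theorem hk oU tU e0 Da Db aU bU ab0.
have [M' MM'] := dM.
have [_ _ MK M'K [K [cK KU K0]]] := MM'.
have dMO : cdiff_pair k Omega M M'.
  by have [? ? ? ? _] := MM'; split=> //; exists K; split=> // x /KU /UOmega.
have imM : M @` Omega = Omega.
  apply/seteqP; split=> [_ [x Ox <-]|x Ox]; first exact: cdiff_preserves dMO Ox.
  by exists (M' x) => //; exact: cdiff_preserves (cdiff_pairC dMO) Ox.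
exists (F \o M); split.
- have -> : F @` Omega = (F \o M) @` Omega by rewrite -image_comp imM.
  apply: (embedding_comp (cdiff_embedding dM hOmega) hF).
  by rewrite imM.
- move=> x [_ nU] /=; rewrite K0// => /KU; exact: nU.
- move=> x D2x; have [z z1 zx] : (phi2 @` closed_eball 0 1) x by rewrite im2.
  have z1' : sqnorm z <= 1 by move: z1; rewrite closed_eball0E.
  have [_ [_ [_ [w Uw Fw]]]] := O_closed z z1.
  rewrite /= -zx Mab//= FinvK; last by exists w => //; exact: UOmega.
  by rewrite gG//; exact: D2phi2.
Qed.
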